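(* Let $g\ge1$. The genus $g$ partition function for the rank two Heisenberg VOA $M^2$ is $$Z^{(g)}_{M^2}(\bm w,\bm\rho)=\det(I-A)^{-1},$$ where $A$ is the infinite matrix with entries, for $a,b\in\mathcal I=\{\pm1,\ldots,\pm g\}$ and $k,l\ge1$, $$A_{ab}(k,l)=\begin{cases}\dfrac{(-1)^k(k+l-1)!}{\sqrt{kl}\,(k-1)!\,(l-1)!}\dfrac{\rho_a^{k/2}\rho_b^{l/2}}{(w_{-a}-w_b)^{k+l}},&a\ne-b,\\[2mm]0,&a=-b.\end{cases}$$
   Context: $w_a\in\mathbb C$ ($a\in\mathcal I$) are distinct and $\rho_a$ ($a\in\mathcal I$, $\rho_{-a}=\rho_a$) are sewing parameters; $\bm w,\bm\rho$ denotes $w_1,w_{-1},\rho_1,\ldots,w_g,w_{-g},\rho_g$. Square roots $\rho_a^{1/2}=\rho_{-a}^{1/2}$ are fixed. $\det(I-A)$ is defined by $\log\det(I-A)=-\sum_{k\ge1}\frac1k\mathrm{Tr}A^k$ (only integer powers of the $\rho_a$ occur). $M^2$ is the rank two Heisenberg VOA generated by commuting weight 1 vectors $h_1,h_2$ ($[h_i(k),h_j(l)]=k\delta_{ij}\delta_{k,-l}$, vacuum $\mathbb 1$); $h_\pm=\frac1{\sqrt2}(h_1\pm ih_2)$, so the only nontrivial commutators are $[h_+(k),h_-(l)]=k\delta_{k,-l}$. The Li–Zamolodchikov metric $\langle\,,\rangle$ is the unique symmetric invertible invariant bilinear form on $M^2$ with $\langle\mathbb 1,\mathbb 1\rangle=1$;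 for it $\langle h_\pm(n)u,v\rangle=-\langle u,h_\pm(-n)v\rangle$. Genus zero correlation functions are the rational functions $Z^{(0)}(v_1,y_1;\ldots;v_n,y_n)=\langle\mathbb 1,Y(v_1,y_1)\cdots Y(v_n,y_n)\mathbb 1\rangle$. For a VOA $V=\oplus_{n\ge0}V_n$ with such a metric, the genus $g$ partition function is the formal series in $\bm\rho$ $$Z_V^{(g)}(\bm w,\bm\rho)=\sum_{b_1,\ldots,b_g}\prod_{a=1}^g\rho_a^{\mathrm{wt}(b_a)}\,Z^{(0)}(\overline b_1,w_{-1};b_1,w_1;\ldots;\overline b_g,w_{-g};b_g,w_g),$$ where each $b_a$ runs over a homogeneous basis of $V$, $\overline b_a$ is the corresponding element of the dual basis with respect to the metric, and $\mathrm{wt}$ is conformal weight. *)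

(* Defs.v *)
From HB Require Import structures.
From mathcomp Require Import all_boot all_order all_algebra.
From mathcomp Require Import boolp classical_sets functions fsbigop reals.
From mathcomp Require Import complex.
From mathcomp Require Import mpoly.

Set Implicit Arguments.
Unset Strict Implicit.
Unset Printing Implicit Defensive.

Import Order.TTheory GRing.Theory Num.Theory.
Local Open Scope classical_set_scope.
Local Open Scope ring_scope.

Record fps (n : nat) (K : Type) := Fps { fcoef : 'X_{1..n} -> K }.

Lemma fpsP n K (f h : fps n K) : fcoef f =1 fcoef h <-> f = h.
Proof. by case: f h => [f] [h]; split=> [/= /funext -> | [->]]. Qed.

HB.instance Definition _ n (K : Type) := [isNew for @fcoef n K].
HB.instance Definition _ n (K : choiceType) := gen_eqMixin (fps n K).
HB.instance Definition _ n (K : choiceType) := gen_choiceMixin (fps n K).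

Section FpsRing.
Variables (n : nat) (K : comNzRingType).
Implicit Types f h k : fps n K.

Definition fps0 : fps n K := Fps (fun=> 0).
Definition fps_opp f : fps n K := Fps (fun m => - fcoef f m).
Definition fps_add f h : fps n K := Fps (fun m => fcoef f m + fcoef h m).
Definition fpsC (c : K) : fps n K := Fps (fun m => if m == 0%MM then c else 0).
Definition fps_mul f h : fps n K := Fps (fun m =>
  \sum_(k : 'X_{1..n < (mdeg m).+1, (mdeg m).+1} | m == (k.1 + k.2)%MM)
    fcoef f k.1 * fcoef h k.2).
Definition fpsX (i : 'I_n) : fps n K := Fps (fun m => (m == U_(i)%MM)%:R).

Fact fps_addA : associative fps_add.
Proof. by move=> f h k; apply/fpsP => m /=; rewrite addrA. Qed.
Fact fps_addC : commutative fps_add.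
Proof. by move=> f h; apply/fpsP => m /=; rewrite addrC. Qed.
Fact fps_add0 : left_id fps0 fps_add.
Proof. by move=> f; apply/fpsP => m /=; rewrite add0r. Qed.
Fact fps_addN : left_inverse fps0 fps_opp fps_add.
Proof. by move=> f; apply/fpsP => m /=; rewrite addNr. Qed.

HB.instance Definition _ :=
  GRing.isZmodule.Build (fps n K) fps_addA fps_addC fps_add0 fps_addN.

(* The ring axioms are inherited from {mpoly K[n]} through truncations.      *)
Let trunc d f : {mpoly K[n]} :=
  \sum_(m : 'X_{1..n < d}) (fcoef f m *: 'X_[m]).

Let coef_trunc d f m : (mdeg m < d)%N -> (trunc d f)@_m = fcoef f m.
Proof. exact: mcoeff_mpoly. Qed.

Let coef_mul d f h m (p q : {mpoly K[n]}) :
    (forall m', (mdeg m' < d)%N -> p@_m' = fcoef f m') ->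
    (forall m', (mdeg m' < d)%N -> q@_m' = fcoef h m') ->
  (mdeg m < d)%N -> (p * q)@_m = fcoef (fps_mul f h) m.
Proof.
move=> pf qh md; rewrite mcoeffM /=; apply: eq_bigr => k _.
by rewrite pf ?qh // (leq_ltn_trans _ md) // -ltnS bmdeg.
Qed.

Fact fps_mulA : associative fps_mul.
Proof.
move=> f h k; apply/fpsP => m; set d := (mdeg m).+1.
have E := @coef_trunc d.
have Ehk m' := @coef_mul d h k m' _ _ (E h) (E k).
have Efh m' := @coef_mul d f h m' _ _ (E f) (E h).
rewrite -(@coef_mul d f (fps_mul h k) m _ _ (E f) Ehk (ltnSn _)).
by rewrite -(@coef_mul d (fps_mul f h) k m _ _ Efh (E k) (ltnSn _)) mulrA.
Qed.

Fact fps_mulC : commutative fps_mul.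
Proof.
move=> f h; apply/fpsP => m; set d := (mdeg m).+1.
have E := @coef_trunc d.
rewrite -(@coef_mul d f h m _ _ (E f) (E h) (ltnSn _)).
by rewrite -(@coef_mul d h f m _ _ (E h) (E f) (ltnSn _)) mulrC.
Qed.

Fact fps_mul1 : left_id (fpsC 1) fps_mul.
Proof.
move=> f; apply/fpsP => m; set d := (mdeg m).+1.
have E := @coef_trunc d f.
have E1 m' : (mdeg m' < d)%N -> (1 : {mpoly K[n]})@_m' = fcoef (fpsC 1) m'.
  by move=> _; rewrite mcoeff1 /=; case: eqP.
by rewrite -(@coef_mul d (fpsC 1) f m _ _ E1 E (ltnSn _)) mul1r E.
Qed.

Fact fps_mulD : left_distributive fps_mul fps_add.
Proof.
move=> f h k; apply/fpsP => m /=; rewrite -big_split /=.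
by apply: eq_bigr => i _; rewrite mulrDl.
Qed.

Fact fps1_neq0 : fpsC 1 != 0.
Proof.
by apply/eqP => /fpsP /(_ 0%MM) /=; rewrite eqxx; apply/eqP; rewrite oner_eq0.
Qed.

HB.instance Definition _ := GRing.Zmodule_isComNzRing.Build (fps n K)
  fps_mulA fps_mulC fps_mul1 fps_mulD fps1_neq0.

Definition fps_unit : pred (fps n K) := fun f => `[< exists h, h * f = 1 >].
Definition fps_inv f : fps n K := xget f [set h | h * f = 1].

Fact fps_mulV : {in fps_unit, left_inverse 1 fps_inv *%R}.
Proof. by move=> f /asboolP [h hf]; rewrite /fps_inv; case: xgetP => // /(_ h). Qed.
Fact fps_unitP f h : h * f = 1 -> fps_unit f.
Proof. by move=> hf; apply/asboolP; exists h. Qed.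
Fact fps_inv_out : {in [predC fps_unit], fps_inv =1 id}.
Proof.
move=> f /= /asboolPn nf; rewrite /fps_inv; case: xgetP => // h _ hf.
by case: nf; exists h.
Qed.

HB.instance Definition _ := GRing.ComNzRing_hasMulInverse.Build (fps n K)
  fps_mulV fps_unitP fps_inv_out.

(* Coefficientwise sum of a family indexed by A, each coefficient of which
   must have only finitely many nonzero contributions. *)
Definition fps_sum (T : choiceType) (A : set T) (F : T -> fps n K) : fps n K :=
  Fps (fun m => \sum_(t \in A) fcoef (F t) m).

End FpsRing.

(* For f without constant term. *)
Definition fps_exp n (C : fieldType) (f : fps n C) : fps n C :=
  fps_sum [set: nat] (fun k => fpsC n (k`!%:R^-1) * f ^+ k).

Section InfiniteMatrix.
Variables (n : nat) (C : fieldType) (T : choiceType) (D : set T).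
Implicit Types A B : T -> T -> fps n C.

Definition imx_mul A B : T -> T -> fps n C :=
  fun i j => fps_sum D (fun c => A i c * B c j).
Definition imx_exp A (k : nat) : T -> T -> fps n C :=
  iter k (imx_mul A) (fun i j => (i == j)%:R).
Definition imx_trace A : fps n C := fps_sum D (fun i => A i i).

(* det (I - A), through log det (I - A) = - \sum_(k >= 1) Tr (A ^ k) / k. *)
Definition imx_det1B A : fps n C :=
  fps_exp (- fps_sum [set k : nat | (0 < k)%N]
               (fun k => fpsC n (k%:R^-1) * imx_trace (imx_exp A k))).

End InfiniteMatrix.

Definition gbin (C : fieldType) (p : int) (i : nat) : C :=
  (\prod_(j < i) (p - j%:Z)%:~R) / i`!%:R.

(* mode u k v is u(k)v, where Y(u, z) = \sum_k u(k) z^(-k-1). *)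
Record voa (C : numClosedFieldType) := VOA {
  voa_sort :> lmodType C;
  mode : voa_sort -> int -> voa_sort -> voa_sort;
  vac : voa_sort;
  conf : voa_sort;
  charge : C;
  mode_linearl : forall k v c u u',
    mode (c *: u + u') k v = c *: mode u k v + mode u' k v;
  mode_linearr : forall u k c v v',
    mode u k (c *: v + v') = c *: mode u k v + mode u k v';
  mode_trunc : forall u v, exists N : int, forall k, N <= k -> mode u k v = 0;
  mode_vac : forall k v, mode vac k v = if k == -1 then v else 0;
  creation : forall u, mode u (-1) vac = u;
  creation0 : forall u k, 0 <= k -> mode u k vac = 0;
  (* the Jacobi identity in components *)
  borcherds : forall (p q r : int) u v x,
    \sum_(i \in [set: nat])
       gbin C p i *: mode (mode u (r + i%:Z) v) (p + q - i%:Z) x =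
    \sum_(i \in [set: nat]) ((-1) ^+ i * gbin C r i) *:
       (mode u (p + r - i%:Z) (mode v (q + i%:Z) x)
        - (-1 : C) ^ r *: mode v (q + r - i%:Z) (mode u (p + i%:Z) x));
  (* L(k) = conf(k+1) *)
  virasoro : forall (k l : int) v,
    mode conf (k + 1) (mode conf (l + 1) v)
      - mode conf (l + 1) (mode conf (k + 1) v) =
    (k - l)%:~R *: mode conf (k + l + 1) v
      + (if k + l == 0 then (k ^+ 3 - k)%:~R / 12%:R * charge else 0) *: v;
  translation : forall u k v,
    mode (mode conf 0 u) k v = - (k%:~R *: mode u (k - 1) v);
  (* V is the sum of the V_k, k >= 0, where V_k is the eigenspace of L(0) *)
  grading : forall v, exists (N : nat) (x : nat -> voa_sort),
    (forall k, mode conf 1 (x k) = k%:R *: x k) /\ v = \sum_(k < N) x k;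
  grading_fin : forall k : nat, exists s : seq voa_sort,
    forall v, mode conf 1 v = k%:R *: v ->
      exists c : nat -> C, v = \sum_(i < size s) c i *: s`_i
}.

Arguments mode {C v} _ _ _ : rename.
Arguments vac {C v} : rename.
Arguments conf {C v} : rename.

Section Voa.
Variables (C : numClosedFieldType) (V : voa C).
Implicit Types (u v : V) (B : V -> V -> C).

Definition vir (k : int) v : V := mode conf (k + 1) v.
Definition has_wt (k : nat) v : Prop := vir 0 v = k%:R *: v.

(* The vertex subalgebra generated by the family h is V. *)
Definition generated_by (J : Type) (h : J -> V) : Prop :=
  forall W : V -> Prop,
    (forall c u v, W u -> W v -> W (c *: u + v)) ->
    W vac -> (forall j, W (h j)) ->
    (forall u k v, W u -> W v -> W (mode u k v)) ->
  forall v, W v.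

(* The last clause is <Y(u,z)x, y> = <x, Y(exp(zL(1)) (-z^-2)^L(0) u, 1/z)y>
   in components, for u of weight n, for which L(1)^i u = 0 when i > n. *)
Definition LiZ_metric B : Prop :=
  [/\ forall c u u' v, B (c *: u + u') v = c * B u v + B u' v,
      forall u v, B u v = B v u,
      forall u, (forall v, B u v = 0) -> u = 0,
      B vac vac = 1 &
      forall (n : nat) u (k : int) x y, has_wt n u ->
        B (mode u k x) y =
        (-1) ^+ n * \sum_(i < n.+1) i`!%:R^-1 *
          B x (mode (iter i (vir 1) u) (n.*2%:Z - k - 2 - (i : nat)%:Z) y)].

Definition heisenberg2 (h : 'I_2 -> V) : Prop :=
  [/\ forall i, has_wt 1 (h i),
      forall i j (k l : int) v,
        mode (h i) k (mode (h j) l v) - mode (h j) l (mode (h i) k v) =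
        (if (i == j) && (k + l == 0) then k%:~R else 0) *: v,
      conf = 2%:R^-1 *: \sum_i mode (h i) (-1) (h i) &
      generated_by h].

Definition homog_basis (I : choiceType) (b : I -> V) (wt : I -> nat) : Prop :=
  [/\ forall i, has_wt (wt i) (b i),
      forall (s : seq I) (c : I -> C), uniq s ->
        \sum_(i <- s) c i *: b i = 0 -> forall i, i \in s -> c i = 0 &
      forall v, exists (s : seq I) (c : I -> C), v = \sum_(i <- s) c i *: b i].

Definition dual_basis B (I : choiceType) (b bd : I -> V) : Prop :=
  forall i j, B (bd i) (b j) = (i == j)%:R.

(* s lists the pairs (v_i, y_i). *)
Section Correlation.
Variables (B : V -> V -> C) (s : seq (V * C)).

(* The coefficient of \prod_i y_i ^ (e i) in
   <vac, Y(v_1, y_1) ... Y(v_n, y_n) vac>. *)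
Definition corr_coef (e : 'I_(size s) -> int) : C :=
  B vac (foldr (fun i u => mode (tnth (in_tuple s) i).1 (- e i - 1) u)
           vac (enum 'I_(size s))).

Definition corr_disc : {mpoly C[size s]} :=
  \prod_(i < size s) \prod_(j < size s | (i < j)%N) ('X_i - 'X_j).

Definition laurent_coef n (P : {mpoly C[n]}) (e : 'I_n -> int) : C :=
  if [forall i, 0 <= e i] then P@_[multinom `|e i|%N | i < n] else 0.

(* corr_disc ^+ N times the formal series above is the polynomial P, that is,
   the series is the expansion of P / corr_disc ^+ N in the domain
   |y_1| > ... > |y_n|. *)
Definition is_corr (N : nat) (P : {mpoly C[size s]}) : Prop :=
  forall e : 'I_(size s) -> int,
    \sum_(m <- msupp (corr_disc ^+ N))
       (corr_disc ^+ N)@_m * corr_coef (fun i => e i - (m i)%:Z) =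
    laurent_coef P e.

(* The value of the rational function P / corr_disc ^+ N, which does not
   depend on the choice of (N, P), at distinct points y_i. *)
Definition corr : C :=
  let y i := (tnth (in_tuple s) i).2 in
  xget 0 [set z | exists N P, is_corr N P /\ z = P.@[y] / corr_disc.@[y] ^+ N].

End Correlation.

End Voa.

(* The set {1, -1, ..., g, -g}; (a, true) stands for a, (a, false) for -a. *)
Definition slab (g : nat) : Type := ('I_g * bool)%type.
Definition sneg g (a : slab g) : slab g := (a.1, ~~ a.2).

Section Genus.
Variables (C : numClosedFieldType) (g : nat) (w : slab g -> C).

(* Series are in the variables rho_a^(1/2), a = 1, ..., g. *)
Definition srho (a : 'I_g) : fps g C := fpsX C a.
Definition rho (a : 'I_g) : fps g C := srho a ^+ 2.

Definition partition_function (V : voa C) (B : V -> V -> C) (I : choiceType)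
    (b bd : I -> V) (wt : I -> nat) : fps g C :=
  fps_sum [set: {ffun 'I_g -> I}] (fun beta =>
    (\prod_(a < g) rho a ^+ wt (beta a)) *
    fpsC g (corr B (flatten
      [seq [:: (bd (beta a), w (a, false)); (b (beta a), w (a, true))]
      | a <- enum 'I_g]))).

Definition sewing_idx : set (slab g * nat) := [set x | (0 < x.2)%N].

Definition sewing_mx (x y : slab g * nat) : fps g C :=
  let: (a, k) := x in let: (b, l) := y in
  if a == sneg b then 0 else
  fpsC g ((-1) ^+ k * ((k + l).-1)`!%:R
          / (sqrtC (k * l)%:R * (k.-1)`!%:R * (l.-1)`!%:R)
          / (w (sneg a) - w b) ^+ (k + l))
  * srho a.1 ^+ k * srho b.1 ^+ l.

End Genus.

(* Main.v *)
(* Let D be the Euler derivation of series in the rho_a^(1/2). As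
   L(0) = \sum_i \sum_(k >= 1) h_i(-k) h_i(k), D Z is the sum over the punctures
   of the insertions of these operators. An annihilation operator h(k) at a
   puncture acts on a basis vector, and by invariance of the metric can be
   replaced by -rho^k h(-k) at the opposite puncture; a creation operator is
   turned by genus zero Zhu recursion into annihilation operators at the other
   punctures. The two moves give a linear recursion, with matrix the transpose of
   A, for the sewn correlation functions of two creation operators, whose
   solution is Z \sum_(n >= 1) (A^n)^T. Hence D Z = 2 Z \sum_(n >= 1) Tr(N A^n)
   with N the diagonal matrix of the mode numbers k. As
   D A = N A + A N, this is also -Z D(log det(I - A)), so Z det(I - A) is constant.
   Everything is done modulo series of order d, where A becomes a finite matrix
   and all sums are finite. *)

Require Import Defs.
From HB Require Import structures.
From mathcomp Require Import all_boot all_order all_algebra.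
From mathcomp Require Import boolp classical_sets cardinality fsbigop.
From mathcomp Require Import reals complex ssrcomplements mpoly.
From mathcomp Require Import ring zify.

Set Implicit Arguments.
Unset Strict Implicit.
Unset Printing Implicit Defensive.

Import Order.TTheory GRing.Theory Num.Theory.
Local Open Scope classical_set_scope.
Local Open Scope ring_scope.

(** * Formal power series and infinite matrices *)

(** The two factors 2 that match in the end have different origins. On the side of Z it is the rank:
    the two fields [h i] do not mix and satisfy the same recursion, so each contributes one copy of
    the trace sum; a single field would give the exponent -1/2. On the side of the determinant it
    comes from D A = N A + A N and the cyclicity of the trace. The main obstacle lies in genus zero.
    A correlation function is the value of a rational function, if there is one, so every product of
    fields must first be shown to expand such a function with poles on the diagonals only. Zhu
    recursion is therefore proved for formal Laurent series, where each term is an explicit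
    expansion of a negative power of y_i - y_j. Rationality follows by induction on the number of
    creation operators, and only then does the recursion pass to values. *)

Lemma sum_only (K : nmodType) (T : finType) (F : T -> K) (t0 : T) :
  (forall t, t != t0 -> F t = 0) -> \sum_t F t = F t0.
Proof.
by move=> F0; rewrite (bigD1 t0) //= big1 ?addr0 // => t tt0; rewrite F0.
Qed.

Section Fps.
Variables (n : nat) (K : comNzRingType).
Implicit Types (f h : fps n K) (m : 'X_{1..n}).

Lemma fcoefD f h m : fcoef (f + h) m = fcoef f m + fcoef h m.
Proof. by []. Qed.
Lemma fcoefN f m : fcoef (- f) m = - fcoef f m.
Proof. by []. Qed.
Lemma fcoef0 m : fcoef (0 : fps n K) m = 0.
Proof. by []. Qed.
Lemma fcoefM f h m : fcoef (f * h) m =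
  \sum_(k : 'X_{1..n < (mdeg m).+1, (mdeg m).+1} | m == (k.1 + k.2)%MM)
    fcoef f k.1 * fcoef h k.2.
Proof. by []. Qed.
Lemma fcoef_sum (T : Type) (r : seq T) (P : pred T) (F : T -> fps n K) m :
  fcoef (\sum_(t <- r | P t) F t) m = \sum_(t <- r | P t) fcoef (F t) m.
Proof. exact: (big_morph (fun f : fps n K => fcoef f m)). Qed.

Lemma fcoefCM (c : K) f m : fcoef (fpsC n c * f) m = c * fcoef f m.
Proof.
have lt0 : (mdeg (0%MM : 'X_{1..n}) < (mdeg m).+1)%N by rewrite mdeg0.
pose k0 : 'X_{1..n < (mdeg m).+1, (mdeg m).+1} :=
  (BMultinom lt0, BMultinom (ltnSn (mdeg m))).
rewrite fcoefM (bigD1 k0) /=; last by rewrite add0m.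
rewrite eqxx big1 ?addr0 // => -[k1 k2] /= /andP[/eqP mE ne].
case: eqP => [k10|]; last by rewrite mul0r.
case/eqP: ne; congr (_, _); apply: val_inj => //=.
by apply: etrans (esym mE); rewrite k10 add0m.
Qed.

Lemma fpsCD : {morph @fpsC n K : x y / x + y}.
Proof. by move=> x y; apply/fpsP => m /=; case: eqP; rewrite ?addr0. Qed.
Lemma fpsCM : {morph @fpsC n K : x y / x * y}.
Proof.
move=> x y; apply/fpsP => m; rewrite fcoefCM /=.
by case: eqP; rewrite ?mulr0.
Qed.
Lemma fpsC1 : fpsC n (1 : K) = 1. Proof. by []. Qed.
Lemma fpsC0 : fpsC n (0 : K) = 0.
Proof. by apply/fpsP => m /=; case: eqP. Qed.
Lemma fpsCN c : fpsC n (- c : K) = - fpsC n c.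
Proof. by apply/fpsP => m /=; case: eqP; rewrite ?oppr0. Qed.
Lemma fpsC_nat k : fpsC n (k%:R : K) = k%:R.
Proof. by elim: k => [|k IH]; rewrite ?fpsC0 // -addn1 !natrD fpsCD IH. Qed.
Lemma fpsC_sum (T : Type) (r : seq T) (P : pred T) (F : T -> K) :
  fpsC n (\sum_(t <- r | P t) F t) = \sum_(t <- r | P t) fpsC n (F t).
Proof. exact: (big_morph _ fpsCD fpsC0). Qed.

(** Congruence modulo series of order [d]. The variables will be the square roots of the rho_a, so
    rho_a itself has order 2. *)
Definition eqd (d : nat) f h := forall m, (mdeg m < d)%N -> fcoef f m = fcoef h m.

Lemma eqd_refl d f : eqd d f f. Proof. by []. Qed.
Lemma eq_eqd d f h : f = h -> eqd d f h. Proof. by move=> ->. Qed.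
Lemma eqd_sym d f h : eqd d f h -> eqd d h f.
Proof. by move=> E m md; rewrite E. Qed.
Lemma eqd_trans d h f k : eqd d f h -> eqd d h k -> eqd d f k.
Proof. by move=> E E' m md; rewrite E ?E'. Qed.
Lemma eqdD d f f' h h' : eqd d f f' -> eqd d h h' -> eqd d (f + h) (f' + h').
Proof. by move=> E E' m md; rewrite !fcoefD E ?E'. Qed.
Lemma eqdN d f f' : eqd d f f' -> eqd d (- f) (- f').
Proof. by move=> E m md; rewrite !fcoefN E. Qed.
Lemma eqdM d f f' h h' : eqd d f f' -> eqd d h h' -> eqd d (f * h) (f' * h').
Proof.
move=> E E' m md; rewrite !fcoefM; apply: eq_bigr => -[k1 k2] /= /eqP /(congr1 (@mdeg n)).
by rewrite mdegD => mE; rewrite E ?E' //; lia.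
Qed.
Lemma eqd_sum d (T : Type) (r : seq T) (P : pred T) (F G : T -> fps n K) :
  (forall t, P t -> eqd d (F t) (G t)) ->
  eqd d (\sum_(t <- r | P t) F t) (\sum_(t <- r | P t) G t).
Proof. by move=> E m md; rewrite !fcoef_sum; apply: eq_bigr => t /E ->. Qed.
Lemma eqdW d d' f h : (d' <= d)%N -> eqd d f h -> eqd d' f h.
Proof. by move=> dd E m md; apply: E; apply: leq_trans dd. Qed.
Lemma eqd_eq f h : (forall d, eqd d f h) -> f = h.
Proof. by move=> E; apply/fpsP => m; apply: (E (mdeg m).+1). Qed.

Lemma eqd0M d d' f h : eqd d f 0 -> eqd d' h 0 -> eqd (d + d') (f * h) 0.
Proof.
move=> E E' m md; rewrite fcoefM fcoef0 big1 // => -[k1 k2] /=.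
move=> /eqP /(congr1 (@mdeg n)); rewrite mdegD => mE.
have [lt|ge] := ltnP (mdeg k1) d; first by rewrite E // mul0r.
by rewrite E' ?mulr0 //; lia.
Qed.
Lemma eqd0Ml d f h : eqd d f 0 -> eqd d (f * h) 0.
Proof. by move=> E; rewrite -(mul0r h); apply: eqdM. Qed.
Lemma eqd0Mr d f h : eqd d h 0 -> eqd d (f * h) 0.
Proof. by move=> E; rewrite mulrC; apply: eqd0Ml. Qed.
Lemma eqd0X d f k : eqd d f 0 -> eqd (k * d) (f ^+ k) 0.
Proof.
move=> E; elim: k => [|k IH]; first by rewrite mul0n => m.
by rewrite exprS mulSn; apply: eqd0M.
Qed.
Lemma eqd_fpsX i : eqd 1 (fpsX K i) 0.
Proof.
move=> m; rewrite ltnS leqn0 mdeg_eq0 => /eqP -> /=.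
by case: eqP => // /(congr1 (@mdeg _)); rewrite mdeg0 mdeg1.
Qed.
Lemma eqd_fpsXn d i k : (d <= k)%N -> eqd d (fpsX K i ^+ k) 0.
Proof.
move=> dk; apply: eqdW dk _; rewrite -[k in eqd k]muln1.
by apply: eqd0X; apply: eqd_fpsX.
Qed.
Lemma eqd_sum0 d (T : Type) (r : seq T) (P : pred T) (F : T -> fps n K) :
  (forall t, P t -> eqd d (F t) 0) -> eqd d (\sum_(t <- r | P t) F t) 0.
Proof.
by move=> F0 m md; rewrite fcoef_sum fcoef0 big1 // => t /F0 ->.
Qed.

Definition euler f : fps n K := Fps (fun m => (mdeg m)%:R * fcoef f m).

Lemma euler_is_additive : additive euler.
Proof. by move=> f h; apply/fpsP => m /=; rewrite mulrDr mulrN. Qed.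
HB.instance Definition _ := GRing.isAdditive.Build (fps n K) (fps n K) euler
  euler_is_additive.

Lemma eulerM f h : euler (f * h) = euler f * h + f * euler h.
Proof.
apply/fpsP => m; rewrite fcoefD /= mulr_sumr -big_split /=.
apply: eq_bigr => -[k1 k2] /= /eqP /(congr1 (@mdeg n)).
move=> /(congr1 (fun i => i%:R : K)); rewrite mdegD natrD => ->; ring.
Qed.
Lemma eulerC c : euler (fpsC n c) = 0.
Proof.
apply/fpsP => m /=; case: eqP => [->|]; rewrite ?mulr0 // mdeg0 mul0r //.
Qed.
Lemma euler1 : euler 1 = 0. Proof. exact: (eulerC 1). Qed.
Lemma eulerCM c f : euler (fpsC n c * f) = fpsC n c * euler f.
Proof. by rewrite eulerM eulerC mul0r add0r. Qed.
Lemma eulerX f k : euler (f ^+ k) = k%:R * (f ^+ k.-1 * euler f).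
Proof.
case: k => [|k]; first by rewrite mul0r euler1.
elim: k => [|k IH]; first by rewrite mulr1n !mul1r.
rewrite exprS eulerM IH /= -[k.+2]addn1 natrD [f ^+ k.+1]exprS; ring.
Qed.
Lemma euler_fpsX i : euler (fpsX K i) = fpsX K i.
Proof.
apply/fpsP => m /=; case: eqP => [->|_]; rewrite ?mulr0 // mdeg1 mulr1 //.
Qed.
Lemma euler_fpsXn i k : euler (fpsX K i ^+ k) = k%:R * fpsX K i ^+ k.
Proof.
rewrite eulerX euler_fpsX; case: k => [|k]; first by rewrite !mul0r.
by rewrite /= -exprSr.
Qed.
Lemma euler_prod (T : Type) (r : seq T) (F : T -> fps n K) (k : T -> nat) :
  (forall t, euler (F t) = (k t)%:R * F t) ->
  euler (\prod_(t <- r) F t) = (\sum_(t <- r) k t)%N%:R * \prod_(t <- r) F t.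
Proof.
move=> E; elim: r => [|t r IH]; first by rewrite !big_nil euler1 mul0r.
rewrite !big_cons eulerM E IH natrD; ring.
Qed.
Lemma eqd_euler d f h : eqd d f h -> eqd d (euler f) (euler h).
Proof. by move=> E m md /=; rewrite E. Qed.
(** A finitely supported sum takes the value 0 when its support is infinite. Here the smallness of
    [F] outside the image of [emb] confines the support of each coefficient of degree below [d] to
    that image. *)
Lemma eqd_fps_sum d (T : choiceType) (A : set T) (F : T -> fps n K)
    (T' : finType) (emb : T' -> T) :
  injective emb -> (forall t', A (emb t')) ->
  (forall t, A t -> (forall t', t <> emb t') -> eqd d (F t) 0) ->
  eqd d (fps_sum A F) (\sum_t' F (emb t')).
Proof.
move=> inj_emb Aemb F0 m md /=; rewrite fcoef_sum.
have -> : \sum_(t \in A) fcoef (F t) m = \sum_(t \in range emb) fcoef (F t) m.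
  apply/esym/fsbig_widen => [t [t' _ <-]//|t [At nt]].
  by apply: F0 => // t' tE; apply: nt; exists t'.
rewrite fsbig_image; last by move=> ? ? _ _; apply: inj_emb.
rewrite fsbig_finite; last exact: finite_finset.
rewrite -big_enum /=; apply: perm_big; apply: uniq_perm.
- exact: finmap.fset_uniq.
- exact: enum_uniq.
by move=> t; rewrite mem_enum in_fset_set ?in_setT ?inE //; apply: finite_finset.
Qed.

End Fps.

(** In characteristic 0 the degree, by which the Euler derivation multiplies a coefficient, vanishes
    only for the constant one. *)
Lemma euler_eq0 (n : nat) (K : numDomainType) (f : fps n K) (c : K) :
  euler f = 0 -> fcoef f 0%MM = c -> f = fpsC n c.
Proof.
move=> f0 fc; apply/fpsP => m /=; case: eqP => [-> //|/eqP m0].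
move/fpsP: f0 => /(_ m) /= /eqP; rewrite mulf_eq0 pnatr_eq0 mdeg_eq0.
by rewrite (negPf m0) => /eqP.
Qed.

Section FpsExp.
Variables (n : nat) (K : numFieldType).
Implicit Types f h : fps n K.

Lemma eqd_fps_exp d f : eqd 1 f 0 ->
  eqd d (fps_exp f) (\sum_(k < d) fpsC n (k`!%:R^-1) * f ^+ k).
Proof.
move=> f0.
apply: (@eqd_fps_sum _ _ _ _ _ _ 'I_d (@nat_of_ord d)) => // [|k _ kd].
  exact: val_inj.
apply: eqd0Mr; apply: (@eqdW _ _ k); last first.
  by rewrite -[k in eqd k]muln1; apply: eqd0X.
by rewrite leqNgt; apply/negP => lt; apply: (kd (Ordinal lt)).
Qed.

Lemma fps_exp_coef0 f : eqd 1 f 0 -> fcoef (fps_exp f) 0%MM = 1.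
Proof.
move=> f0; rewrite (eqd_fps_exp (d := 1)) ?mdeg0 // big_ord1 expr0 mulr1.
by rewrite fact0 invr1 /= eqxx.
Qed.

Lemma euler_fps_exp f : eqd 1 f 0 -> euler (fps_exp f) = euler f * fps_exp f.
Proof.
move=> f0; apply: eqd_eq => d.
(* One term more than needed for order [d]: the derivation kills the term 0 and lowers the other
   exponents by one, which leaves [d] terms. *)
apply: (@eqd_trans _ _ _ (euler (\sum_(k < d.+1) fpsC n (k`!%:R^-1) * f ^+ k))).
  by apply: eqd_euler; apply: eqdW (leqnSn d) _; apply: eqd_fps_exp.
rewrite raddf_sum big_ord_recl /= expr0 mulr1 eulerC add0r.
apply: (@eqd_trans _ _ _ (euler f * \sum_(k < d) fpsC n (k`!%:R^-1) * f ^+ k)).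
  rewrite mulr_sumr; apply: eqd_sum => k _.
  rewrite eulerCM eulerX /= /bump /= add1n -fpsC_nat mulrA -fpsCM factS natrM.
  rewrite invfM mulrAC mulVf ?pnatr_eq0 // mul1r.
  by rewrite [_ * euler f]mulrC mulrCA.
by apply: eqdM => //; apply/eqd_sym/eqd_fps_exp.
Qed.

End FpsExp.

Section InfiniteMatrix.
Variables (n : nat) (K : numFieldType).

Lemma map_mx_eulerM (N : nat) (A C : 'M[fps n K]_N) :
  map_mx (@euler n K) (A * C) =
  map_mx (@euler n K) A * C + A * map_mx (@euler n K) C.
Proof.
apply/matrixP => i j; rewrite !mxE raddf_sum -big_split /=.
by apply: eq_bigr => l _; rewrite eulerM !mxE.
Qed.

(* Cyclicity of the trace lets euler A be moved to the front of every term of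
   the Leibniz rule. *)
Lemma trace_eulerX (N : nat) (A : 'M[fps n K]_N) k m :
  \tr (map_mx (@euler n K) (A ^+ k) * A ^+ m) =
  k%:R * \tr (map_mx (@euler n K) A * A ^+ (k + m).-1).
Proof.
elim: k m => [|k IH] m.
  rewrite mul0r expr0 (_ : map_mx _ _ = 0) ?mul0r ?raddf0 //.
  apply/matrixP => i j; rewrite !mxE; case: eqP => _; first exact: euler1.
  by rewrite mulr0n raddf0.
rewrite exprS map_mx_eulerM mulrDl mxtraceD -!mulrA -exprD.
rewrite [X in _ + X]mxtrace_mulC -[_ *m _]mulrA -exprSr IH addnS /=.
by rewrite -[k.+1]addn1 natrD mulrDl mul1r addrC.
Qed.

Variables (T : choiceType) (D : set T) (A : T -> T -> fps n K).
Variables (d N : nat) (emb : 'I_N -> T).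
Hypothesis inj_emb : injective emb.
Hypothesis D_emb : forall i, D (emb i).
Hypothesis A_small : forall x y, D x -> D y ->
  (forall i, x <> emb i) \/ (forall i, y <> emb i) -> eqd d (A x y) 0.
Hypothesis A_ord : forall x y, D x -> D y -> eqd 1 (A x y) 0.

Let M : 'M[fps n K]_N := \matrix_(i, j) A (emb i) (emb j).

Lemma eqd_imx_exp k i j :
  eqd d (imx_exp D A k (emb i) (emb j)) ((M ^+ k) i j).
Proof.
elim: k i j => [|k IH] i j.
  by rewrite /= expr0 mxE (inj_eq inj_emb).
rewrite exprS mxE /=; apply: (eqd_trans (eqd_fps_sum inj_emb D_emb _)).
  by move=> t Dt nt; apply: eqd0Ml; apply: A_small => //; right.
by apply: eqd_sum => c _; rewrite mxE; apply: eqdM => //; apply: IH.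
Qed.

(** Only positive powers: a diagonal entry at an index outside the finite block then starts with a
    small entry of [A], whereas the identity is 1 there. *)
Lemma eqd_imx_trace k : eqd d (imx_trace D (imx_exp D A k.+1)) (\tr (M ^+ k.+1)).
Proof.
apply: (eqd_trans (eqd_fps_sum inj_emb D_emb _)) => [t Dt nt|].
  rewrite /= /imx_mul; apply: (eqd_trans (eqd_fps_sum inj_emb D_emb _)).
    by move=> c Dc _; apply: eqd0Ml; apply: A_small => //; left.
  by apply: eqd_sum0 => c _; apply: eqd0Ml; apply: A_small => //; left.
by apply: eqd_sum => i _; apply: eqd_imx_exp.
Qed.

Lemma eqd_mxX k i j : eqd k ((M ^+ k) i j) 0.
Proof.
elim: k i j => [|k IH] i j; first by [].
rewrite exprS mxE; apply: eqd_sum0 => c _; rewrite mxE.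
by apply: (@eqd0M _ _ 1 k) => //; apply: A_ord.
Qed.

Let L := fps_sum [set k : nat | (0 < k)%N]
  (fun k => fpsC n (k%:R^-1) * imx_trace D (imx_exp D A k)).

Lemma eqd_log_det :
  eqd d L (\sum_(k < d) fpsC n (k.+1%:R^-1) * \tr (M ^+ k.+1)).
Proof.
apply: (eqd_trans (@eqd_fps_sum _ _ _ _ _ _ 'I_d (fun k => k.+1) _ _ _)).
- by move=> i j [] /val_inj.
- by [].
- move=> k k0 nk; apply: eqd0Mr; case: k k0 nk => // k _ nk.
  apply: (eqd_trans (eqd_imx_trace k)); apply: eqd_sum0 => i _.
  apply: (@eqdW _ _ k.+1); last exact: eqd_mxX.
  by rewrite ltnW // ltnS leqNgt; apply/negP => lt; apply: (nk (Ordinal lt)).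
by apply: eqd_sum => k _; apply: eqdM => //; apply: eqd_imx_trace.
Qed.

(** The factor [k] that cyclicity produces from the [k]-th power cancels the 1/k of the logarithm
    and leaves a geometric series. *)
Lemma eqd_euler_log_det :
  eqd d (euler L) (\sum_(k < d) \tr (map_mx (@euler n K) M * M ^+ k)).
Proof.
apply: (eqd_trans (eqd_euler eqd_log_det)).
rewrite raddf_sum; apply: eqd_sum => k _ /=; rewrite eulerCM.
rewrite (_ : euler _ = \tr (map_mx (@euler n K) (M ^+ k.+1) * M ^+ 0)); last first.
  by rewrite expr0 mulr1 /mxtrace raddf_sum; apply: eq_bigr => i _; rewrite mxE.
rewrite trace_eulerX addn0 mulrA -fpsC_nat -fpsCM mulVf ?pnatr_eq0 //.
by rewrite fpsC1 mul1r.
Qed.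

End InfiniteMatrix.

(** * Modes in a vertex operator algebra *)

Lemma fsum_nat (M : nmodType) (F : nat -> M) (n : nat) :
  (forall i, (n <= i)%N -> F i = 0) ->
  \sum_(i \in [set: nat]) F i = \sum_(i < n) F i.
Proof.
move=> F0; rewrite (fsbig_ord _ n F).
apply/esym/fsbig_widen => // i [_] /= ni; apply: F0.
by rewrite leqNgt; apply/negP.
Qed.

Section GeneralizedBinomial.
Variable C : numClosedFieldType.

Lemma gbin0 p : gbin C p 0 = 1.
Proof. by rewrite /gbin big_ord0 fact0 divr1. Qed.

Lemma gbinS p i : gbin C p i.+1 * i.+1%:R = gbin C p i * (p - i%:Z)%:~R.
Proof.
rewrite /gbin big_ord_recr /= factS natrM invfM.
rewrite -!mulrA; congr (_ * _).
by rewrite [_^-1 * i.+1%:R]mulrC mulKf ?pnatr_eq0 // mulrC.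
Qed.

Lemma gbinS_div p i : gbin C p i.+1 = gbin C p i * (p - i%:Z)%:~R / i.+1%:R.
Proof. by rewrite -gbinS mulfK ?pnatr_eq0. Qed.

Lemma gbin_bin (m i : nat) : gbin C m i = 'C(m, i)%:R.
Proof.
elim: i => [|i IH]; first by rewrite gbin0 bin0.
rewrite gbinS_div IH; apply: (canLR (mulfK _)); rewrite ?pnatr_eq0 //.
rewrite -natrM [('C(_, _) * _)%N]mulnC mul_bin_left mulnC.
have [le|lt] := leqP i m; last by rewrite bin_small // mul0n mulr0n mul0r.
by rewrite natrM subzn.
Qed.

Lemma gbin_absorb p i : gbin C (p + 1) i.+1 * i.+1%:R = gbin C p i * (p + 1)%:~R.
Proof.
rewrite /gbin big_ord_recl /= factS natrM invfM subr0.
rewrite (eq_bigr (fun j : 'I_i => (p - j%:Z)%:~R)); last first.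
  by move=> j _; congr (_%:~R); rewrite /bump /=; lia.
rewrite -!mulrA [_^-1 * i.+1%:R]mulrC mulKf ?pnatr_eq0 //.
by rewrite [LHS]mulrC mulrA.
Qed.

Lemma gbin_pascal p i : gbin C (p + 1) i.+1 = gbin C p i.+1 + gbin C p i.
Proof.
have ne0 : i.+1%:R != 0 :> C by rewrite pnatr_eq0.
apply: (mulIf ne0); rewrite gbin_absorb mulrDl gbinS -mulrDr.
congr (_ * _); rewrite -[i.+1%:R]/(i.+1%:Z%:~R) -intrD; congr (_%:~R); lia.
Qed.

(** Up to factorials the product is a falling factorial of length [m + l]; the next two identities
    read it in two ways. *)
Lemma gbin_fact p m l :
  gbin C p m * gbin C (p - m%:Z) l * (m`! * l`!)%:R =
  \prod_(j < m + l) (p - j%:Z)%:~R.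
Proof.
rewrite /gbin big_split_ord /= natrM mulrACA.
rewrite mulfVK ?pnatr_eq0 -?lt0n ?fact_gt0 //.
rewrite mulfVK ?pnatr_eq0 -?lt0n ?fact_gt0 //.
by congr (_ * _); apply: eq_bigr => j _; congr (_%:~R); rewrite /=; lia.
Qed.

Lemma gbin_swap p m l :
  gbin C p m * gbin C (p - m%:Z) l = gbin C p l * gbin C (p - l%:Z) m.
Proof.
have ne0 : (m`! * l`!)%:R != 0 :> C by rewrite pnatr_eq0 -lt0n muln_gt0 !fact_gt0.
by apply: (mulIf ne0); rewrite gbin_fact mulnC gbin_fact addnC.
Qed.

Lemma gbin_add p l m :
  gbin C p (l + m) * gbin C (l + m)%N l = gbin C p l * gbin C (p - l%:Z) m.
Proof.
have ne0 : (l`! * m`!)%:R != 0 :> C by rewrite pnatr_eq0 -lt0n muln_gt0 !fact_gt0.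
apply: (mulIf ne0); rewrite gbin_fact gbin_bin -mulrA -natrM.
have := bin_fact (leq_addr m l); rewrite addKn => ->; rewrite /gbin.
by rewrite mulfVK // pnatr_eq0 -lt0n fact_gt0.
Qed.

Lemma gbin_neg (k l : nat) : gbin C (- k.+1%:Z) l = (-1) ^+ l * 'C(k + l, l)%:R.
Proof.
elim: l => [|l IH]; first by rewrite gbin0 bin0 mul1r.
rewrite gbinS_div IH; apply: (canLR (mulfK _)); rewrite ?pnatr_eq0 //.
rewrite (_ : (_ - _)%:~R = - (k + l).+1%:R); last first.
  by rewrite -[_%:R]/((k + l).+1%:Z%:~R) -rmorphN; congr (_%:~R); lia.
rewrite exprS mulN1r mulrN !mulNr; congr (- _).
rewrite -!mulrA -!natrM; congr (_ * _%:R).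
by rewrite addnS mulnC mul_bin_diag mulnC.
Qed.

Lemma gbin_zero i : gbin C 0 i = (i == 0)%:R.
Proof. by rewrite (gbin_bin 0) bin0n. Qed.

Lemma gbin_m1 i : gbin C (-1) i = (-1) ^+ i.
Proof. by rewrite (gbin_neg 0) add0n binn mulr1. Qed.

End GeneralizedBinomial.

Section VoaTheory.
Variables (C : numClosedFieldType) (V : voa C).
Implicit Types (u v x : V) (k p q r : int).

HB.instance Definition _ u k :=
  GRing.isLinear.Build C V V _ (mode u k) (mode_linearr u k).

Definition mode_l k v u : V := mode u k v.
HB.instance Definition _ k v :=
  GRing.isLinear.Build C V V _ (mode_l k v) (mode_linearl k v).

Lemma mode0r u k : mode u k 0 = 0. Proof. exact: raddf0. Qed.
Lemma mode0l k v : mode 0 k v = 0. Proof. exact: (raddf0 (mode_l k v)). Qed.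
Lemma modeZr u k c v : mode u k (c *: v) = c *: mode u k v.
Proof. exact: linearZ. Qed.
Lemma modeZl u k c v : mode (c *: u) k v = c *: mode u k v.
Proof. exact: (linearZZ (mode_l k v)). Qed.
Lemma modeDr u k v v' : mode u k (v + v') = mode u k v + mode u k v'.
Proof. exact: raddfD. Qed.
Lemma modeBr u k v v' : mode u k (v - v') = mode u k v - mode u k v'.
Proof. exact: raddfB. Qed.
Lemma modeDl u u' k v : mode (u + u') k v = mode u k v + mode u' k v.
Proof. exact: (raddfD (mode_l k v)). Qed.
Lemma mode_sumr u k (T : Type) (s : seq T) (P : pred T) (F : T -> V) :
  mode u k (\sum_(t <- s | P t) F t) = \sum_(t <- s | P t) mode u k (F t).
Proof. exact: raddf_sum. Qed.
Lemma mode_suml k v (T : Type) (s : seq T) (P : pred T) (F : T -> V) :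
  mode (\sum_(t <- s | P t) F t) k v = \sum_(t <- s | P t) mode (F t) k v.
Proof. exact: (raddf_sum (mode_l k v)). Qed.

Lemma mode_small u v : exists M : nat, forall k, M%:Z <= k -> mode u k v = 0.
Proof.
have [N N0] := mode_trunc u v; exists `|N|%N => k le; apply: N0; lia.
Qed.

(** The Jacobi identity at [p = 0], where [gbin C 0 i] leaves a single term on its left. *)
Lemma mode_iter u r v q x (M : nat) :
  (forall i : nat, (M <= i)%N -> mode v (q + i%:Z) x = 0) ->
  (forall i : nat, (M <= i)%N -> mode u i%:Z x = 0) ->
  mode (mode u r v) q x = \sum_(i < M) ((-1) ^+ i * gbin C r i) *:
    (mode u (r - i%:Z) (mode v (q + i%:Z) x)
     - (-1 : C) ^ r *: mode v (q + r - i%:Z) (mode u i%:Z x)).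
Proof.
move=> v0 u0; have := borcherds 0 q r u v x.
rewrite (fsum_nat (n := 1)) => [|[//|i] _]; last by rewrite gbin_zero scale0r.
rewrite big_ord1 gbin0 scale1r !addr0 add0r ?subr0 => ->.
rewrite (fsum_nat (n := M)) => [|i Mi].
  by apply: eq_bigr => i _; rewrite !add0r.
by rewrite v0 // add0r u0 // !mode0r scaler0 subr0 scaler0.
Qed.

(** The Jacobi identity at [r = 0], where a single term is left on its right. *)
Lemma mode_comm u p v q x (M : nat) :
  (forall i : nat, (M <= i)%N -> mode u i%:Z v = 0) ->
  mode u p (mode v q x) = mode v q (mode u p x) +
    \sum_(i < M) gbin C p i *: mode (mode u i%:Z v) (p + q - i%:Z) x.
Proof.
move=> u0; have := borcherds p q 0 u v x.
rewrite (fsum_nat (n := M)) => [|i Mi]; last by rewrite add0r u0 // mode0l scaler0.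
rewrite [RHS](fsum_nat (n := 1)) => [|[//|i] _]; last first.
  by rewrite gbin_zero mulr0 scale0r.
rewrite big_ord1 gbin0 expr0 mulr1 expr0z !scale1r !addr0 ?subr0 => E.
under eq_bigr => i _ do rewrite -[i%:Z]add0r.
rewrite -[RHS]addrC; under eq_bigr => i _ do rewrite [0 + _ in X in _ - X]add0r.
by rewrite E subrK.
Qed.

End VoaTheory.

(** * The rank two Heisenberg algebra *)

Section Heisenberg.
Variables (C : numClosedFieldType) (V : voa C) (h : 'I_2 -> V).
Hypothesis V_heis : heisenberg2 h.
Implicit Types (u v x : V) (k l p q r : int).

Lemma heis_wt i : has_wt 1 (h i).
Proof. by case: V_heis. Qed.

Lemma heis_comm i j k l v :
  mode (h i) k (mode (h j) l v) = mode (h j) l (mode (h i) k v) +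
    (if (i == j) && (k + l == 0) then k%:~R else 0) *: v.
Proof. by case: V_heis => _ <- _ _; rewrite addrC subrK. Qed.

(** The filtration by the number of creation operators, not by weight: every nonnegative mode lowers
    it by one, and this is the measure in the induction for rationality. *)
Inductive fock : nat -> V -> Prop :=
| fock_vac n : fock n vac
| fock_lin n c u v : fock n u -> fock n v -> fock n (c *: u + v)
| fock_h n i (k : nat) v : fock n v -> fock n.+1 (mode (h i) (- k.+1%:Z) v).

Lemma fock0 n : fock n 0.
Proof. by rewrite -(addNr vac) -scaleN1r; apply: fock_lin; apply: fock_vac. Qed.
Lemma fockZ n c v : fock n v -> fock n (c *: v).
Proof. by move=> Fv; rewrite -[_ *: _]addr0; apply: fock_lin Fv _; apply: fock0. Qed.
Lemma fockD n u v : fock n u -> fock n v -> fock n (u + v).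
Proof. by move=> Fu Fv; rewrite -[u]scale1r; apply: fock_lin. Qed.
Lemma fockW n m v : fock n v -> (n <= m)%N -> fock m v.
Proof.
move=> Fv; elim: Fv m => {n v}.
- by move=> n m _; apply: fock_vac.
- by move=> n c u v _ IHu _ IHv m nm; apply: fock_lin; [apply: IHu|apply: IHv].
by move=> n i k v _ IH [|m] // nm; apply: fock_h; apply: IH.
Qed.

(** Each commutator met on the way to the vacuum removes one creation operator. *)
Lemma fock_ann n v i (k : nat) : fock n v ->
  if n is n'.+1 then fock n' (mode (h i) k%:Z v) else mode (h i) k%:Z v = 0.
Proof.
elim=> {n v}.
- by move=> n; rewrite creation0 //; case: n => // n; apply: fock0.
- move=> [|n] c u v _ IHu _ IHv; rewrite modeDr modeZr.
    by rewrite IHu IHv scaler0 addr0.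
  exact: fock_lin.
move=> n j l v Fv IH; rewrite heis_comm; apply: fockD; last exact: fockZ.
case: n Fv IH => [|n] Fv IH; last exact: fock_h.
by rewrite IH mode0r; apply: fock0.
Qed.

Let isfock v := exists n, fock n v.

Let F_lin c u v : isfock u -> isfock v -> isfock (c *: u + v).
Proof.
move=> [n Fu] [m Fv]; exists (maxn n m); apply: fock_lin.
  by apply: fockW Fu _; apply: leq_maxl.
by apply: fockW Fv _; apply: leq_maxr.
Qed.
Let F0 : isfock 0. Proof. by exists 0%N; apply: fock0. Qed.
Let FZ c v : isfock v -> isfock (c *: v).
Proof. by move=> Fv; rewrite -[_ *: _]addr0; apply: F_lin. Qed.
Let FD u v : isfock u -> isfock v -> isfock (u + v).
Proof. by move=> Fu; rewrite -[u]scale1r; apply: F_lin. Qed.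

Let F_h i k v : isfock v -> isfock (mode (h i) k v).
Proof.
move=> [n Fv]; case: k => k.
  by have := fock_ann i k Fv; case: n Fv => [|n] _ E; [rewrite E|exists n].
by rewrite NegzE; exists n.+1; apply: fock_h.
Qed.

(** Generation is closed under all products [mode u k v], so the induction must also carry that
    every mode of [v] preserves the Fock space; for a product this comes from [mode_iter]. *)
Lemma fockT v : exists n, fock n v.
Proof.
suff: isfock v /\ forall k x, isfock x -> isfock (mode v k x) by case.
have [_ _ _ gen] := V_heis.
apply: (gen (fun v => isfock v /\ forall k x, isfock x -> isfock (mode v k x))).
- move=> c u w [Fu FFu] [Fw FFw]; split=> [|k x Fx]; first exact: F_lin.
  by rewrite modeDl modeZl; apply: F_lin; [apply: FFu|apply: FFw].
- split=> [|k x Fx]; first by exists 0%N; apply: fock_vac.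
  by rewrite mode_vac; case: ifP.
- move=> j; split=> [|k x]; last exact: F_h.
  by rewrite -(creation (h j)); apply: F_h; exists 0%N; apply: fock_vac.
move=> u r w [Fu FFu] [Fw FFw]; split=> [|q x Fx]; first exact: FFu.
have [M M0] := mode_small u x; have [N N0] := mode_small w x.
rewrite (mode_iter _ (M := maxn M (N + `|q|))) => [|i|i]; first last.
- by rewrite geq_max => /andP[Mi _]; apply: M0.
- by rewrite geq_max => /andP[_ Ni]; apply: N0; lia.
elim/big_ind: _ => // i _; apply: FZ; apply: FD; first exact/FFu/FFw.
by rewrite -scaleN1r; apply: FZ; apply: FZ; exact/FFw/FFu.
Qed.

Lemma heis_ind (P : V -> Prop) :
  P vac -> (forall c u v, P u -> P v -> P (c *: u + v)) ->
  (forall i (k : nat) v, P v -> P (mode (h i) (- k.+1%:Z) v)) ->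
  forall v, P v.
Proof. by move=> Pvac Plin Ph v; have [n] := fockT v; elim=> *; auto. Qed.

(** [h(0)] kills the vacuum and commutes with the creation operators, since its commutators carry
    the factor k = 0. *)
Lemma heis_mode0 i v : mode (h i) 0 v = 0.
Proof.
elim/heis_ind: v => [|c u v IHu IHv|j k v IH]; first by rewrite creation0.
  by rewrite modeDr modeZr IHu IHv scaler0 addr0.
by rewrite heis_comm IH mode0r add0r /= add0r; case: ifP; rewrite scale0r.
Qed.

Lemma heis_mode_heis i j (k : nat) :
  mode (h i) k%:Z (h j) = ((i == j) && (k == 1%N))%:R *: vac.
Proof.
rewrite -{1}(creation (h j)) heis_comm creation0 // mode0r add0r.
by rewrite (_ : (k%:Z + -1 == 0) = (k == 1%N)); [case: andP => // -[_ /eqP ->]|lia].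
Qed.

(* As h(0) = 0, the two tails of the normally ordered product h(-1)h give the
   same sum up to a shift of the index, which absorbs the factor 1/2 of conf. *)
Lemma conf_mode1 v : exists M0, forall M, (M0 <= M)%N ->
  mode conf 1 v = \sum_i \sum_(k < M) mode (h i) (- k.+1%:Z) (mode (h i) k.+1%:Z v).
Proof.
have [M0 hM0] : exists M0, forall i k, M0%:Z <= k -> mode (h i) k v = 0.
  have [N0 H0] := mode_small (h ord0) v; have [N1 H1] := mode_small (h ord_max) v.
  exists (maxn N0 N1) => i k le.
  have : i = ord0 \/ i = ord_max.
    by case: i => -[|[|//]] ?; [left|right]; apply: val_inj.
  by case=> ->; [apply: H0|apply: H1]; lia.
exists M0 => M le; case: V_heis => _ _ -> _.
rewrite modeZl mode_suml scaler_sumr; apply: eq_bigr => i _.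
rewrite (mode_iter _ (M := M.+1)) => [|k Mk|k Mk]; first last.
- by apply: hM0; lia.
- by apply: hM0; lia.
rewrite (eq_bigr (fun k : 'I_M.+1 => mode (h i) (- k.+1%:Z) (mode (h i) k.+1%:Z v)
   + mode (h i) (- k%:Z) (mode (h i) k%:Z v))); last first.
  move=> k _; rewrite gbin_m1 -exprMn mulrNN mulr1 expr1n scale1r.
  rewrite (_ : (-1) ^ (-1) = -1 :> C); last by rewrite exprN1 invrN1.
  by rewrite scaleN1r opprK; congr (mode _ _ (mode _ _ _) + mode _ _ _); lia.
rewrite big_split /= big_ord_recr /= (hM0 _ M.+1%:Z); last by lia.
rewrite mode0r addr0 big_ord_recl /= heis_mode0 ?mode0r add0r.
rewrite -mulr2n -scaler_nat scalerA mulVf ?pnatr_eq0 // scale1r.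
by [].
Qed.

(** Half of the terms contain a mode of index at least 2 on [h i]; in the other half a mode of index
    0 or 1 gives a multiple of the vacuum, which the remaining nonnegative mode kills. *)
Lemma conf_mode_heis i (n : nat) : mode conf n.+2%:Z (h i) = 0.
Proof.
case: V_heis => _ _ -> _.
rewrite modeZl mode_suml big1 ?scaler0 // => j _.
have h2 (k : nat) : mode (h j) (n.+2%:Z + k%:Z) (h i) = 0.
  by rewrite -PoszD heis_mode_heis andbF scale0r.
rewrite (mode_iter _ (M := 2)) => [|//|k Mk]; last first.
  by rewrite heis_mode_heis andbC (gtn_eqF Mk) scale0r.
rewrite big1 // => k _; rewrite h2 mode0r sub0r heis_mode_heis modeZr.
by rewrite creation0 ?scaler0 ?oppr0 ?scaler0 //; case: k => /= k; lia.
Qed.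

Lemma vir1_heis i : vir 1 (h i) = 0. Proof. exact: (conf_mode_heis i 0). Qed.

(** Only L(-1)h, known from [translation], and L(0)h = h enter the commutator formula; they
    contribute -(k + 1) and 1. *)
Lemma vir0_heis_comm i k v :
  vir 0 (mode (h i) k v) = mode (h i) k (vir 0 v) - k%:~R *: mode (h i) k v.
Proof.
rewrite /vir add0r (mode_comm _ _ _ (M := 2)) => [|[|[|j]] // _]; last first.
  exact: conf_mode_heis.
congr (_ + _); rewrite big_ord_recl big_ord1 /= translation.
have := heis_wt i; rewrite /has_wt /vir add0r scale1r => ->.
rewrite /bump /= gbin0 (gbin_bin _ 1) bin1 !scale1r.
have e0 : 1 + k - 0%Z = k + 1 by lia.
have e1 : 1 + k - (1 + 0)%N%:Z = k by lia.
rewrite e0 e1 addrK.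
by rewrite intrD scalerDl scale1r opprD addrNK.
Qed.

Section Metric.
Variable B : V -> V -> C.
Hypothesis B_LiZ : LiZ_metric B.

Lemma B_sym u v : B u v = B v u. Proof. by case: B_LiZ. Qed.
Lemma B_nondeg u : (forall v, B u v = 0) -> u = 0.
Proof. by case: B_LiZ => _ _ H _ _; apply: H. Qed.
Lemma B_vac : B vac vac = 1. Proof. by case: B_LiZ. Qed.
Lemma B_linl c u u' v : B (c *: u + u') v = c * B u v + B u' v.
Proof. by case: B_LiZ. Qed.
Lemma BDl u u' v : B (u + u') v = B u v + B u' v.
Proof. by rewrite -[u in LHS]scale1r B_linl mul1r. Qed.
Lemma B0l v : B 0 v = 0.
Proof. by apply: (addrI (B 0 v)); rewrite -BDl !addr0. Qed.
Lemma BZl c u v : B (c *: u) v = c * B u v.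
Proof. by rewrite -[_ *: _]addr0 B_linl B0l addr0. Qed.
Lemma BNl u v : B (- u) v = - B u v. Proof. by rewrite -scaleN1r BZl mulN1r. Qed.
Lemma BBl u u' v : B (u - u') v = B u v - B u' v. Proof. by rewrite BDl BNl. Qed.
Lemma B_suml (T : Type) (s : seq T) (P : pred T) (F : T -> V) v :
  B (\sum_(t <- s | P t) F t) v = \sum_(t <- s | P t) B (F t) v.
Proof. exact: (big_morph (fun u => B u v) (fun x y => BDl x y v) (B0l v)). Qed.
Lemma B0r v : B v 0 = 0. Proof. by rewrite B_sym B0l. Qed.
Lemma BZr c u v : B v (c *: u) = c * B v u. Proof. by rewrite B_sym BZl B_sym. Qed.
Lemma BDr u u' v : B v (u + u') = B v u + B v u'.
Proof. by rewrite B_sym BDl !(B_sym v). Qed.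
Lemma B_sumr (T : Type) (s : seq T) (P : pred T) (F : T -> V) v :
  B v (\sum_(t <- s | P t) F t) = \sum_(t <- s | P t) B v (F t).
Proof. by rewrite B_sym B_suml; apply: eq_bigr => t _; rewrite B_sym. Qed.

(** The weight is 1 and L(1)h = 0, so the invariance formula keeps its first term, with mode 2 - k -
    2 = -k. *)
Lemma heis_adj i k u v : B (mode (h i) k u) v = - B u (mode (h i) (- k) v).
Proof.
case: B_LiZ => _ _ _ _ /(_ 1%N (h i) k u v (heis_wt i)) ->.
rewrite big_ord_recl big_ord1 /= vir1_heis mode0l B0r mulr0 addr0.
rewrite fact0 invr1 mul1r expr1 mulN1r; congr (- B _ (mode _ _ _)); lia.
Qed.

(** Each summand h(-k)h(k) of L(0) is self-adjoint, because the two signs from [heis_adj] cancel. *)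
Lemma vir0_adj u v : B (vir 0 u) v = B u (vir 0 v).
Proof.
rewrite /vir add0r; case: (conf_mode1 u) => M1 H1; case: (conf_mode1 v) => M2 H2.
rewrite (H1 (maxn M1 M2)) ?leq_maxl // (H2 (maxn M1 M2)) ?leq_maxr //.
rewrite B_suml B_sumr; apply: eq_bigr => i _.
rewrite B_suml B_sumr; apply: eq_bigr => k _.
by rewrite !heis_adj !opprK.
Qed.

End Metric.

End Heisenberg.

(** * Expansions of rational functions *)

Section FormalSeries.
Variables (C : numClosedFieldType) (n : nat).
Implicit Types (p q : {mpoly C[n]}) (S T : ('I_n -> int) -> C) (e : 'I_n -> int).
Implicit Types (i j a b : 'I_n).

(* The product of p with the formal Laurent series of coefficients S. *)
Definition pact p S e : C :=
  \sum_(m <- msupp p) p@_m * S (fun i => e i - (m i)%:Z).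

Lemma pactE k p S e : (msize p <= k)%N ->
  pact p S e = \sum_(m : 'X_{1..n < k}) p@_m * S (fun i => e i - (m i)%:Z).
Proof.
move=> le_pk; rewrite /pact; pose I : subFinType _ := 'X_{1..n < k}.
rewrite (big_mksub I) ?msupp_uniq //=; first last.
  by move=> x /msize_mdeg_lt /leq_trans; apply.
by rewrite big_rmcond //= => i /memN_msupp_eq0 ->; rewrite mul0r.
Qed.

Lemma pactX m S e : pact 'X_[m] S e = S (fun i => e i - (m i)%:Z).
Proof. by rewrite /pact msuppX big_seq1 mcoeffX eqxx mul1r. Qed.

Lemma pact_lin c p q S e : pact (c *: p + q) S e = c * pact p S e + pact q S e.
Proof.
set k := maxn (maxn (msize p) (msize q)) (msize (c *: p + q)).
rewrite !(@pactE k) ?leq_max ?leqnn ?orbT // mulr_sumr -big_split /=.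
by apply: eq_bigr => m _; rewrite mcoeffD mcoeffZ mulrDl mulrA.
Qed.
Lemma pact0 S e : pact 0 S e = 0.
Proof. by rewrite /pact msupp0 big_nil. Qed.
Lemma pactZ c p S e : pact (c *: p) S e = c * pact p S e.
Proof. by rewrite -[c *: p]addr0 pact_lin pact0 addr0. Qed.
Lemma pactD p q S e : pact (p + q) S e = pact p S e + pact q S e.
Proof. by rewrite -[p]scale1r pact_lin mul1r scale1r. Qed.
Lemma pactN p S e : pact (- p) S e = - pact p S e.
Proof. by rewrite -scaleN1r pactZ mulN1r. Qed.
Lemma pact1 S e : pact 1 S e = S e.
Proof.
rewrite -mpolyX0 pactX; congr S; apply/funext => i.
by rewrite mnm0E subr0.
Qed.

Lemma pactM p q S e : pact (p * q) S e = pact p (pact q S) e.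
Proof.
elim/mpolyind: p => [|c m p _ _ IH]; first by rewrite mul0r !pact0.
rewrite mulrDl !pactD IH -scalerAl !pactZ; congr (c * _ + _).
rewrite pactX; elim/mpolyind: q {IH} => [|d k q _ _ IHq].
  by rewrite mulr0 !pact0.
rewrite mulrDr !pactD IHq -scalerAr !pactZ; congr (d * _ + _).
rewrite -mpolyXD !pactX; congr S; apply/funext => i.
by rewrite mnmDE PoszD opprD addrA.
Qed.

Lemma pact_lincomb c p S T e :
  pact p (fun e => c * S e + T e) e = c * pact p S e + pact p T e.
Proof.
rewrite /pact mulr_sumr -big_split /=; apply: eq_bigr => m _.
by rewrite mulrDr mulrCA.
Qed.

Lemma laurent_coef_lin c p q e :
  laurent_coef (c *: p + q) e = c * laurent_coef p e + laurent_coef q e.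
Proof.
by rewrite /laurent_coef; case: ifP; rewrite ?mcoeffD ?mcoeffZ // mulr0 addr0.
Qed.
Lemma laurent_coef0 e : laurent_coef (0 : {mpoly C[n]}) e = 0.
Proof. by rewrite /laurent_coef mcoeff0 if_same. Qed.

Lemma mcoeffMX_gt p (m k : 'X_{1..n}) : ~~ (m <= k)%MM -> (p * 'X_[m])@_k = 0.
Proof.
move=> nle; apply: memN_msupp_eq0; rewrite (perm_mem (msuppMX p m)).
by apply: contra nle => /mapP[m' _ ->]; apply/mnm_lepP => i; rewrite mnmDE leq_addr.
Qed.

Lemma pact_laurent p q e : pact p (laurent_coef q) e = laurent_coef (p * q) e.
Proof.
elim/mpolyind: p => [|c m p _ _ IH]; first by rewrite mul0r pact0 laurent_coef0.
rewrite mulrDl -scalerAl laurent_coef_lin -IH pact_lin pactX; congr (c * _ + _).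
rewrite mulrC /laurent_coef; case: ifP => [/forallP em|/forallP nem].
  rewrite ifT; last by apply/forallP => i; have := em i; lia.
  rewrite -(mcoeffMX q m); congr mcoeff; apply/mnmP => i.
  by rewrite mnmDE !mnmE; have := em i; lia.
case: ifP => // /forallP e0; rewrite mcoeffMX_gt //.
apply/negP => /mnm_lepP mk; apply: nem => i.
by have := mk i; have := e0 i; rewrite mnmE; lia.
Qed.

Lemma laurent_coef_inj p q : laurent_coef p =1 laurent_coef q -> p = q.
Proof.
move=> E; apply/mpolyP => m; have := E (fun i => (m i)%:Z).
rewrite /laurent_coef (introT forallP) => [|i]; last by [].
have -> // : [multinom `|(m i)%:Z|%N | i < n] = m.
by apply/mnmP => i; rewrite mnmE.
Qed.

Definition disc : {mpoly C[n]} :=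
  \prod_(i < n) \prod_(j < n | (i < j)%N) ('X_i - 'X_j).

Variable y : 'I_n -> C.
Hypothesis inj_y : injective y.

(* S is the expansion of a rational function with poles on the diagonals only,
   whose value at y is z. *)
Definition has_value S (z : C) := exists N P,
  pact (disc ^+ N) S =1 laurent_coef P /\ z = P.@[y] / disc.@[y] ^+ N.

Lemma disc_neq0 : disc.@[y] != 0.
Proof.
rewrite /disc rmorph_prod; apply/prodf_neq0 => i _.
rewrite rmorph_prod; apply/prodf_neq0 => j ij /=.
rewrite mevalB !mevalXU subr_eq0 (inj_eq inj_y).
by apply/eqP => E; rewrite E ltnn in ij.
Qed.

(** Division by [disc] is not unique on formal series, so the two numerators are compared as
    polynomials after [S] is multiplied by both powers of [disc]. *)
Lemma has_value_unique S z z' : has_value S z -> has_value S z' -> z = z'.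
Proof.
move=> [N [P [E ->]]] [N' [P' [E' ->]]].
have EP : disc ^+ N' * P = disc ^+ N * P'.
  apply: laurent_coef_inj => e; rewrite -!pact_laurent.
  have <- : pact (disc ^+ N) S = laurent_coef P by apply/funext.
  have <- : pact (disc ^+ N') S = laurent_coef P' by apply/funext.
  by rewrite -!pactM mulrC.
apply/eqP; rewrite eqr_div ?expf_neq0 ?disc_neq0 //.
have := congr1 (meval y) EP; rewrite !mevalM !rmorphXn /= => H.
by rewrite mulrC H mulrC.
Qed.

Lemma has_value_lin c S T z z' : has_value S z -> has_value T z' ->
  has_value (fun e => c * S e + T e) (c * z + z').
Proof.
move=> [N [P [E ->]]] [N' [P' [E' ->]]].
exists (N + N')%N, (c *: (disc ^+ N' * P) + disc ^+ N * P'); split.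
  move=> e; rewrite pact_lincomb laurent_coef_lin -!pact_laurent.
  have <- : pact (disc ^+ N) S = laurent_coef P by apply/funext.
  have <- : pact (disc ^+ N') T = laurent_coef P' by apply/funext.
  by rewrite -!pactM [disc ^+ N' * _]mulrC -exprD.
rewrite mevalD mevalZ !mevalM !rmorphXn /= exprD.
have d0 := disc_neq0.
by field; rewrite ?expf_neq0 ?d0.
Qed.

Lemma has_value0 : has_value (fun=> 0) 0.
Proof.
exists 0%N, 0; split=> [e|]; last by rewrite meval0 mul0r.
by rewrite expr0 pact1 laurent_coef0.
Qed.

Lemma has_value_sum (T : Type) (s : seq T) (P : pred T) (F : T -> ('I_n -> int) -> C)
    (z : T -> C) : (forall t, P t -> has_value (F t) (z t)) ->
  has_value (fun e => \sum_(t <- s | P t) F t e) (\sum_(t <- s | P t) z t).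
Proof.
move=> Fz; elim: s => [|t s IH].
  rewrite big_nil (_ : (fun e => _) = fun=> 0); first exact: has_value0.
  by apply/funext => e; rewrite big_nil.
rewrite big_cons (_ : (fun e => _) =
   fun e => if P t then F t e + \sum_(t <- s | P t) F t e else \sum_(t <- s | P t) F t e).
  case: ifP => // Pt; rewrite -[z t]mul1r.
  under [X in has_value X]eq_fun => e do rewrite -[F t e]mul1r.
  by apply: has_value_lin => //; apply: Fz.
by apply/funext => e; rewrite big_cons.
Qed.

Lemma has_value_scale c S z : has_value S z -> has_value (fun e => c * S e) (c * z).
Proof.
move=> Sz; have := has_value_lin c Sz has_value0.
by under [X in has_value X _]eq_fun => e do rewrite addr0; rewrite addr0.
Qed.

Lemma has_value_opp S z : has_value S z -> has_value (fun e => - S e) (- z).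
Proof.
move=> Sz; rewrite -mulN1r.
rewrite (_ : (fun e => - S e) = fun e => -1 * S e); first exact: has_value_scale.
by apply/funext => e; rewrite mulN1r.
Qed.

Lemma disc_factor i j : i != j -> exists q, disc = ('X_i - 'X_j) * q.
Proof.
have lt i' j' : (i' < j')%N -> exists q, disc = ('X_i' - 'X_j') * q.
  move=> ij; rewrite /disc (bigD1 i') //= (bigD1 j') //= -mulrA.
  by eexists; reflexivity.
rewrite -val_eqE /= neq_ltn => /orP[|/lt [q ->]]; first exact: lt.
by exists (- q); rewrite mulrN -mulNr opprB.
Qed.

(** One more power of [disc] absorbs the new pole: if [disc = ('X_i - 'X_j) * q], the numerator
    becomes [q * P]. *)
Lemma has_value_divX i j S T z : i != j -> pact ('X_i - 'X_j) T =1 S ->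
  has_value S z -> has_value T (z / (y i - y j)).
Proof.
move=> ij ET [N [P [E ->]]]; have [q qE] := disc_factor ij.
exists N.+1, (q * P); split=> [e|].
  have -> : disc ^+ N.+1 = q * (disc ^+ N * ('X_i - 'X_j)).
    by rewrite exprSr mulrCA [q * _]mulrC -qE.
  have {}ET : pact ('X_i - 'X_j) T = S by apply/funext.
  have {}E : pact (disc ^+ N) S = laurent_coef P by apply/funext.
  rewrite pactM (_ : pact (_ * _) T = laurent_coef P) ?pact_laurent //.
  by apply/funext => e'; rewrite pactM ET E.
have := disc_neq0; rewrite qE mevalM mevalB !mevalXU mulf_eq0 negb_or => /andP[y0 q0].
rewrite !mevalM exprSr exprMn.
by field; rewrite ?y0 ?q0 ?expf_neq0.
Qed.

Lemma has_value_one : has_value (fun e => [forall i, e i == 0]%:R) 1.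
Proof.
exists 0%N, 1; split=> [e|]; last by rewrite meval1 expr0 divr1.
rewrite expr0 pact1 /laurent_coef mcoeff1.
case: (boolP [forall i, e i == 0]) => [/forallP e0|/forallP ne0].
  rewrite (introT forallP) => [|i]; last by rewrite (eqP (e0 i)).
  by rewrite (introT eqP) //; apply/mnmP => i; rewrite mnmE mnm0E (eqP (e0 i)).
case: ifP => // /forallP e0; case: eqP => // /mnmP m0; case: ne0 => i.
by have := m0 i; have := e0 i; rewrite mnmE mnm0E; lia.
Qed.

Definition shift e i (a : int) : 'I_n -> int := fun t => e t + (if t == i then a else 0).

Lemma shiftC e i j (c d : int) : shift (shift e i c) j d = shift (shift e j d) i c.
Proof. by apply/funext => t; rewrite /shift addrAC. Qed.
Lemma shiftD e i (c d : int) : shift (shift e i c) i d = shift e i (c + d).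
Proof. by apply/funext => t; rewrite /shift; case: eqP; rewrite ?addr0 ?addrA. Qed.
Lemma shift0 e i : shift e i 0 = e.
Proof. by apply/funext => t; rewrite /shift; case: eqP; rewrite addr0. Qed.

Lemma pactB_X i j S e :
  pact ('X_i - 'X_j) S e = S (shift e i (-1)) - S (shift e j (-1)).
Proof.
rewrite pactD pactN !pactX; congr (S _ - S _); apply/funext => t;
  by rewrite /shift mnm1E eq_sym; case: eqP; rewrite ?subr0 ?addr0.
Qed.

(* The expansion of (y_a - y_b)^(-p) S in the domain |y_a| > |y_b|. *)
Definition expand (p : nat) a b S e : C := \sum_(m \in [set: nat])
  (-1) ^+ m * gbin C (- p%:Z) m * S (shift (shift e a (p + m)%N%:Z) b (- m%:Z)).

(** Uniformity in [c] matters: the terms of [expand] raise the exponent of y_a while lowering that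
    of y_b, and this bound makes their sum finite. *)
Definition bounded b a S := forall e, exists M : nat, forall m : nat, (M <= m)%N ->
  forall c, S (shift (shift e a c) b (- m%:Z)) = 0.

Lemma expandE (p : nat) a b S e : bounded b a S -> exists M0, forall M, (M0 <= M)%N ->
  expand p a b S e = \sum_(m < M)
    (-1) ^+ m * gbin C (- p%:Z) m * S (shift (shift e a (p + m)%N%:Z) b (- m%:Z)).
Proof.
move=> bS; have [M0 H0] := bS e; exists M0 => M leM; apply: fsum_nat => m leMm.
by rewrite H0 ?mulr0 // (leq_trans leM).
Qed.

Lemma expand0 a b S : bounded b a S -> expand 0 a b S = S.
Proof.
move=> bS; apply/funext => e; have [M0 /(_ M0.+1 (leqnSn _)) ->] := expandE 0 e bS.
rewrite big_ord_recl big1 => [|m _]; last first.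
  by rewrite oppr0 gbin_zero mulr0 mul0r.
by rewrite gbin0 expr0 !mul1r oppr0 !shift0 addr0.
Qed.

(** Coefficient by coefficient this is Pascal's rule for -p = -(p + 1) + 1. *)
Lemma pact_expand (p : nat) a b S : a != b -> bounded b a S ->
  pact ('X_a - 'X_b) (expand p.+1 a b S) =1 expand p a b S.
Proof.
move=> ab bS e; rewrite pactB_X.
have [M1 H1] := expandE p.+1 (shift e a (-1)) bS.
have [M2 H2] := expandE p.+1 (shift e b (-1)) bS.
have [M3 H3] := expandE p e bS.
pose M := maxn M1 (maxn M2 M3).
(* The sum coming from ['X_b] is cut one term earlier, since its term [m] pairs with the terms
   [m.+1] of the other two. *)
rewrite (H1 M.+1) ?(H2 M) ?(H3 M.+1); try by rewrite ?leqW // /M !leq_max ?leqnn ?orbT.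
rewrite big_ord_recl [RHS]big_ord_recl -addrA -sumrB; congr (_ + _).
  rewrite !gbin0 !expr0 !mul1r; congr S.
  by rewrite shiftD; congr shift; congr shift; lia.
apply: eq_bigr => m _; rewrite lift0 /=.
set s := shift (shift e a (p + m.+1)%N%:Z) b (- m.+1%:Z).
have -> : shift (shift (shift e a (-1)) a (p.+1 + m.+1)%N%:Z) b (- m.+1%:Z) = s.
  by rewrite shiftD; congr shift; congr shift; lia.
have -> : shift (shift (shift e b (-1)) a (p.+1 + m)%N%:Z) b (- m%:Z) = s.
  rewrite [shift (shift e b _) a _]shiftC shiftD /s addSnnS.
  by congr shift; lia.
rewrite -mulrBl; congr (_ * _).
rewrite (_ : - p%:Z = - p.+1%:Z + 1); last by lia.
by rewrite gbin_pascal exprS; ring.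
Qed.

Lemma has_value_expand (p : nat) a b S z : a != b -> bounded b a S -> has_value S z ->
  has_value (expand p a b S) (z / (y a - y b) ^+ p).
Proof.
move=> ab bS Sz; elim: p => [|p IH]; first by rewrite expand0 // expr0 divr1.
rewrite exprSr invfM mulrA; apply: has_value_divX IH => //.
exact: pact_expand.
Qed.

End FormalSeries.

(** * Genus zero correlation functions *)

Definition setv (I : eqType) (U : Type) (v : I -> U) (j : I) (w : U) : I -> U :=
  fun t => if t == j then w else v t.

Section SetV.
Variables (I : eqType) (U : Type).
Implicit Types (v : I -> U) (i j : I) (w : U).

Lemma setv_eq v j w : setv v j w j = w. Proof. by rewrite /setv eqxx. Qed.
Lemma setv_neq v i j w : i != j -> setv v j w i = v i.
Proof. by rewrite /setv => /negPf ->. Qed.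
Lemma setv_setv v j w w' : setv (setv v j w) j w' = setv v j w'.
Proof. by apply/funext => t; rewrite /setv; case: eqP. Qed.
Lemma setvC v i j w w' : i != j ->
  setv (setv v i w) j w' = setv (setv v j w') i w.
Proof.
move=> ij; apply/funext => t; rewrite /setv; case: eqP => [->|//].
by rewrite eq_sym (negPf ij).
Qed.
Lemma setv_id v j : setv v j (v j) = v.
Proof. by apply/funext => t; rewrite /setv; case: eqP => [->|]. Qed.

End SetV.

Section Correlator.
Variables (C : numClosedFieldType) (V : voa C) (h : 'I_2 -> V).
Hypothesis V_heis : heisenberg2 h.
Variable B : V -> V -> C.
Hypothesis B_LiZ : LiZ_metric B.
Variable n : nat.
Implicit Types (v : 'I_n -> V) (e : 'I_n -> int) (x u : V) (s : seq 'I_n).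

Definition corr_seq s v e u : V :=
  foldr (fun i u => mode (v i) (- e i - 1) u) u s.

Definition corr_series v e : C := B vac (corr_seq (enum 'I_n) v e vac).

Lemma eq_corr_seq s v v' e e' u : {in s, v =1 v'} -> {in s, e =1 e'} ->
  corr_seq s v e u = corr_seq s v' e' u.
Proof.
move=> Ev Ee; elim: s Ev Ee => //= i s IH Ev Ee.
rewrite Ev ?Ee ?mem_head // IH // => j js; [apply: Ev|apply: Ee];
  by rewrite inE js orbT.
Qed.

Lemma corr_seq_lin s v e c u u' :
  corr_seq s v e (c *: u + u') = c *: corr_seq s v e u + corr_seq s v e u'.
Proof. by elim: s => //= i s ->; rewrite mode_linearr. Qed.

Lemma corr_seq0 s v e : corr_seq s v e 0 = 0.
Proof. by elim: s => //= i s ->; rewrite mode0r. Qed.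

Lemma corr_seqZ s v e c u : corr_seq s v e (c *: u) = c *: corr_seq s v e u.
Proof. by rewrite -[c *: u]addr0 corr_seq_lin corr_seq0 addr0. Qed.
Lemma corr_seqD s v e u u' :
  corr_seq s v e (u + u') = corr_seq s v e u + corr_seq s v e u'.
Proof. by rewrite -[u]scale1r corr_seq_lin !scale1r. Qed.
Lemma corr_seq_sum s v e (T : Type) (r : seq T) (P : pred T) (F : T -> V) :
  corr_seq s v e (\sum_(t <- r | P t) F t) =
  \sum_(t <- r | P t) corr_seq s v e (F t).
Proof. exact: (big_morph _ (corr_seqD s v e) (corr_seq0 s v e)). Qed.

Lemma enum_ord_split (j : 'I_n) : exists s1 s2, [/\ enum 'I_n = s1 ++ j :: s2,
  forall i, (i \in s1) = (i < j)%N & forall i, (i \in s2) = (j < i)%N].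
Proof.
have : j \in enum 'I_n by rewrite mem_enum.
have : sorted ltn (map val (enum 'I_n)) by rewrite val_enum_ord iota_ltn_sorted.
have mem_e : forall i, i \in enum 'I_n by move=> i; rewrite mem_enum.
move: mem_e => /[swap] srt /[swap] /splitPr js.
case: js srt => s1 s2; rewrite map_cat /= sorted_pairwise; last exact: ltn_trans.
rewrite pairwise_cat /= allrel_consr => /and3P[/andP[/allP l1 /allrelP l12] _].
move=> /andP[/allP l2 _] mem_e; exists s1, s2; split=> // i.
  apply/idP/idP => [is1|ij]; first by apply: l1; apply: map_f.
  have := mem_e i; rewrite mem_cat inE => /or3P[//|/eqP ij'|is2].
    by rewrite ij' ltnn in ij.
  by have := l2 _ (map_f val is2); rewrite /= ltnNge ltnW.
apply/idP/idP => [is2|ij]; first by apply: l2; apply: map_f.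
have := mem_e i; rewrite mem_cat inE => /or3P[is1|/eqP ij'|//].
  by have := l1 _ (map_f val is1); rewrite /= ltnNge ltnW.
by rewrite ij' ltnn in ij.
Qed.

Section Field.
Variable a : V.

(** The commutator formula is applied at each factor in turn; the mode p + q - l of [mode a l (v i)]
    is the one that belongs to an exponent raised by l - p. *)
Lemma corr_seq_comm s v e (p : int) u (L : nat) : uniq s ->
  (forall i (l : nat), (L <= l)%N -> mode a l%:Z (v i) = 0) ->
  mode a p (corr_seq s v e u) = corr_seq s v e (mode a p u) +
    \sum_(i <- s) \sum_(l < L) gbin C p l *:
      corr_seq s (setv v i (mode a l%:Z (v i))) (shift e i (l%:Z - p)) u.
Proof.
elim: s => [|j s IH] /=; first by rewrite big_nil addr0.
move=> /andP[js us] aL; rewrite (mode_comm _ _ _ (M := L)) => [|l]; last exact: aL.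
rewrite IH // modeDr -addrA; congr (_ + _).
rewrite big_cons [RHS]addrC mode_sumr; congr (_ + _).
  rewrite !big_seq; apply: eq_bigr => i iS.
  have ji : j != i by apply: contraNneq js => ->.
  rewrite mode_sumr; apply: eq_bigr => l _.
  by rewrite modeZr setv_neq // /shift (negPf ji) addr0.
apply: eq_bigr => l _; rewrite setv_eq; congr (_ *: _).
rewrite (@eq_corr_seq s v (setv v j (mode a l%:Z (v j))) e (shift e j (l%:Z - p))).
- by congr mode; rewrite /shift eqxx; lia.
- by move=> i iS; rewrite setv_neq //; apply: contraNneq js => <-.
move=> i iS; rewrite /shift ifF ?addr0 //; apply/negbTE.
by apply: contraNneq js => <-.
Qed.

End Field.

(** Lowering the exponent at [j] raises the mode of [v j], and the vector on which this mode acts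
    involves only operators to the right of [j], hence not the exponent at [i]. *)
Lemma bounded_corr_series v (i j : 'I_n) : (i < j)%N -> bounded j i (corr_series v).
Proof.
move=> ij e; have [s1 [s2 [sE m1 m2]]] := enum_ord_split j.
have [M HM] := mode_small (v j) (corr_seq s2 v e vac).
exists (M + `|e j|)%N.+1 => m leM c.
rewrite /corr_series sE /corr_seq foldr_cat /= -!/(corr_seq _ _ _ _).
rewrite (@eq_corr_seq s2 v v _ e) // => [|t]; last first.
  rewrite m2 => jt; rewrite /shift -!val_eqE /= (gtn_eqF jt).
  by rewrite (gtn_eqF (ltn_trans ij jt)) !addr0.
rewrite HM ?corr_seq0 ?(B0r B_LiZ) //.
by rewrite /shift eqxx -val_eqE /= (gtn_eqF ij); lia.
Qed.

Lemma corr_series_split v e j s1 s2 : enum 'I_n = s1 ++ j :: s2 ->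
  corr_series v e = B vac (corr_seq s1 v e (mode (v j) (- e j - 1) (corr_seq s2 v e vac))).
Proof. by move=> sE; rewrite /corr_series sE /corr_seq foldr_cat. Qed.

Lemma B_vac_heis i k x : B vac (mode (h i) (- k.+1%:Z) x) = 0.
Proof.
by rewrite (B_sym B_LiZ) (heis_adj V_heis B_LiZ) opprK creation0 // (B0r B_LiZ) oppr0.
Qed.

Lemma eventually_fin (T : finType) (P : T -> nat -> Prop) :
  (forall t, exists M0, forall M, (M0 <= M)%N -> P t M) ->
  exists M0, forall t M, (M0 <= M)%N -> P t M.
Proof.
move=> /choice[f fP]; exists (\max_t f t) => t M le; apply: fP.
exact: leq_trans (leq_bigmax t) le.
Qed.

Section Recursion.
Variables (v : 'I_n -> V) (j : 'I_n) (w : V) (a : 'I_2) (k L : nat).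
Let W := setv v j w.
Hypothesis WL : forall i (l : nat), (L <= l)%N -> mode (h a) l%:Z (W i) = 0.
Let X i l := corr_series (setv W i (mode (h a) l%:Z (W i))).

(** The negative mode is moved to the left, where it vanishes against the vacuum; the commutators
    with the operators left of [j] remain. *)
Lemma corr_series_rec_left s1 s2 e (m : nat) : enum 'I_n = s1 ++ j :: s2 ->
  (forall i, (i \in s1) = (i < j)%N) -> (forall i, (i \in s2) = (j < i)%N) ->
  B vac (corr_seq s1 W e (mode (h a) (- k.+1%:Z - m%:Z)
           (mode w (- e j - 1 + m%:Z) (corr_seq s2 W e vac)))) =
  - \sum_(i < n | (i < j)%N) \sum_(l < L) gbin C (- k.+1%:Z - m%:Z) l *
      X i l (shift (shift e i (k.+1 + l + m)%N%:Z) j (- m%:Z)).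
Proof.
move=> sE m1 m2; have us1 : uniq s1.
  by have := enum_uniq 'I_n; rewrite sE cat_uniq => /and3P[].
set x := mode w _ _.
have p0 : - k.+1%:Z - m%:Z = - (k + m).+1%:Z by lia.
have := corr_seq_comm e (- k.+1%:Z - m%:Z) x us1 WL; rewrite p0.
move=> /(congr1 (B vac)); rewrite B_vac_heis (BDr B_LiZ) => /esym/eqP.
rewrite addr_eq0 => /eqP ->; congr (- _); rewrite (B_sumr B_LiZ).
rewrite big_uniq // (eq_bigl _ _ m1); apply: eq_bigr => i ij.
have nji : (j == i) = false by rewrite -val_eqE /= (gtn_eqF ij).
rewrite (B_sumr B_LiZ); apply: eq_bigr => l _; rewrite (BZr B_LiZ); congr (_ * _).
rewrite /X (corr_series_split _ _ sE) setv_neq ?nji // /W setv_eq -/W; congr (B vac _).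
rewrite (@eq_corr_seq s2 _ W _ e) => [|t|t]; first last.
- rewrite m2 => jt; rewrite /shift -!val_eqE /= (gtn_eqF jt).
  by rewrite (gtn_eqF (ltn_trans ij jt)) !addr0.
- by rewrite m2 => jt; rewrite setv_neq // -val_eqE /= (gtn_eqF (ltn_trans ij jt)).
have -> : - shift (shift e i (k.+1 + l + m)%N%:Z) j (- m%:Z) j - 1 =
    - e j - 1 + m%:Z by rewrite /shift eqxx nji; lia.
apply: eq_corr_seq => // t; rewrite m1 => tj.
rewrite /shift -!val_eqE /= (ltn_eqF tj) addr0; case: eqP => // _; lia.
Qed.

(** The nonnegative mode is moved to the right, where it kills the vacuum. *)
Lemma corr_series_rec_right s1 s2 e (m : nat) : enum 'I_n = s1 ++ j :: s2 ->
  (forall i, (i \in s1) = (i < j)%N) -> (forall i, (i \in s2) = (j < i)%N) ->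
  B vac (corr_seq s1 W e (mode w (- e j - 1 - k.+1%:Z - m%:Z)
           (mode (h a) m%:Z (corr_seq s2 W e vac)))) =
  \sum_(i < n | (j < i)%N) \sum_(l < L) gbin C m%:Z l *
      X i l (shift (shift e j (k.+1 + m)%N%:Z) i (l%:Z - m%:Z)).
Proof.
move=> sE m1 m2; have us2 : uniq s2.
  by have := enum_uniq 'I_n; rewrite sE cat_uniq /= => /and4P[].
rewrite (corr_seq_comm e m%:Z vac us2 WL) creation0 // corr_seq0 add0r.
rewrite mode_sumr corr_seq_sum (B_sumr B_LiZ).
rewrite big_uniq // (eq_bigl _ _ m2); apply: eq_bigr => i ij.
have nji : (j == i) = false by rewrite -val_eqE /= (ltn_eqF ij).
rewrite mode_sumr corr_seq_sum (B_sumr B_LiZ); apply: eq_bigr => l _.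
rewrite modeZr corr_seqZ (BZr B_LiZ); congr (_ * _).
rewrite /X (corr_series_split _ _ sE) setv_neq ?nji // /W setv_eq -/W; congr (B vac _).
rewrite (@eq_corr_seq s1 _ W _ e) => [|t|t]; first last.
- rewrite m1 => tj; rewrite /shift -!val_eqE /= (ltn_eqF tj).
  by rewrite (ltn_eqF (ltn_trans tj ij)) !addr0.
- by rewrite m1 => tj; rewrite setv_neq // -val_eqE /= (ltn_eqF (ltn_trans tj ij)).
congr corr_seq.
have -> : - shift (shift e j (k.+1 + m)%N%:Z) i (l%:Z - m%:Z) j - 1 =
    - e j - 1 - k.+1%:Z - m%:Z by rewrite /shift eqxx nji; lia.
congr mode; apply: eq_corr_seq => // t; rewrite m2 => jt.
by rewrite /shift -!val_eqE /= (gtn_eqF jt) addr0.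
Qed.

(** Formal Zhu recursion. The two halves of [mode_iter] give the punctures left and right of [j];
    summing over its index yields expansions of powers of y_i - y_j, by [gbin_swap] on the left and
    [gbin_add] on the right, each in the domain fixed by the order of the operators. *)
Lemma corr_series_rec e : corr_series (setv v j (mode (h a) (- k.+1%:Z) w)) e =
  - \sum_(i < n | i != j) \sum_(l < L) gbin C (- k.+1%:Z) l *
     (if (i < j)%N then expand (k.+1 + l) i j (X i l) e
      else (-1) ^+ (k.+1 + l) * expand (k.+1 + l) j i (X i l) e).
Proof.
have [s1 [s2 [sE m1 m2]]] := enum_ord_split j.
have [M1 H1] : exists M0, forall (t : 'I_n * 'I_L) M, (M0 <= M)%N -> (t.1 < j)%N ->
    expand (k.+1 + t.2) t.1 j (X t.1 t.2) e = \sum_(m < M)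
    (-1) ^+ m * gbin C (- (k.+1 + t.2)%N%:Z) m *
    X t.1 t.2 (shift (shift e t.1 (k.+1 + t.2 + m)%N%:Z) j (- m%:Z)).
  apply: eventually_fin => -[i l] /=; case: (ltnP i j) => [ij|_]; last by exists 0%N.
  have [M0 HM] := expandE (k.+1 + l) e
    (bounded_corr_series (setv W i (mode (h a) l%:Z (W i))) ij).
  by exists M0 => M /HM.
have [M2 H2] : exists M0, forall (t : 'I_n * 'I_L) M, (M0 <= M)%N -> (j < t.1)%N ->
    expand (k.+1 + t.2) j t.1 (X t.1 t.2) e = \sum_(m < M)
    (-1) ^+ m * gbin C (- (k.+1 + t.2)%N%:Z) m *
    X t.1 t.2 (shift (shift e j (k.+1 + t.2 + m)%N%:Z) t.1 (- m%:Z)).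
  apply: eventually_fin => -[i l] /=; case: (ltnP j i) => [ij|_]; last by exists 0%N.
  have [M0 HM] := expandE (k.+1 + l) e
    (bounded_corr_series (setv W i (mode (h a) l%:Z (W i))) ij).
  by exists M0 => M /HM.
have [N1 HN1] := mode_small w (corr_seq s2 W e vac).
have [N2 HN2] := mode_small (h a) (corr_seq s2 W e vac).
(* [L] is included because the expansion at a puncture right of [j] is cut at [M - l]. *)
pose M := (M1 + M2 + N1 + N2 + `|e j| + L)%N.+1.
rewrite (corr_series_split _ _ sE) setv_eq.
have eqs s u : j \notin s ->
    corr_seq s (setv v j (mode (h a) (- k.+1%:Z) w)) e u = corr_seq s W e u.
  move=> js; apply: eq_corr_seq => // t ts.
  by rewrite /W !setv_neq //; apply: contraNneq js => <-.
rewrite !eqs ?m1 ?m2 ?ltnn // (mode_iter _ (M := M)) => [|m leM|m leM]; first last.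
- by apply: HN2; rewrite /M in leM *; lia.
- by apply: HN1; rewrite /M in leM *; lia.
rewrite corr_seq_sum (B_sumr B_LiZ).
have sgn : (-1) ^ (- k.+1%:Z) = (-1) ^+ k.+1 :> C by rewrite -exprnN invr_sign.
rewrite (eq_bigr (fun m : 'I_M =>
  - (\sum_(i < n | (i < j)%N) \sum_(l < L) gbin C (- k.+1%:Z) l *
      ((-1) ^+ m * gbin C (- (k.+1 + l)%N%:Z) m *
       X i l (shift (shift e i (k.+1 + l + m)%N%:Z) j (- m%:Z)))) +
  - (\sum_(i < n | (j < i)%N) \sum_(l < L) (-1) ^+ k.+1 *
      ((-1) ^+ m * (gbin C (- k.+1%:Z) m * gbin C m%:Z l) *
       X i l (shift (shift e j (k.+1 + m)%N%:Z) i (l%:Z - m%:Z)))))); last first.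
  move=> m _; rewrite corr_seqZ (BZr B_LiZ) corr_seqD -scaleN1r scalerA corr_seqZ.
  rewrite (BDr B_LiZ) (BZr B_LiZ) (corr_series_rec_left _ _ sE m1 m2).
  rewrite (corr_series_rec_right _ _ sE m1 m2).
  rewrite mulrDr mulrN sgn; congr (- _ + _).
    rewrite mulr_sumr; apply: eq_bigr => i _; rewrite mulr_sumr; apply: eq_bigr => l _.
    rewrite (_ : - (k.+1 + l)%N%:Z = - k.+1%:Z - l%:Z); last by lia.
    rewrite -[LHS]mulrA [gbin _ _ m * (_ * _)]mulrA gbin_swap; ring.
  rewrite mulN1r mulNr mulrN; congr (- _); rewrite !mulr_sumr.
  apply: eq_bigr => i _; rewrite !mulr_sumr; apply: eq_bigr => l _; ring.
rewrite big_split /= !sumrN -opprD; congr (- _).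
rewrite [RHS](bigID (fun i : 'I_n => (i < j)%N)) /=; congr (_ + _).
  rewrite exchange_big; apply: eq_big => [i|i ij].
    by rewrite -val_eqE /= neq_ltn; case: ltngtP.
  rewrite exchange_big; apply: eq_bigr => l _; rewrite ij -mulr_sumr.
  by rewrite (H1 (i, l) M) // /M; lia.
rewrite exchange_big; apply: eq_big => [i|i ij].
  by rewrite -val_eqE /= neq_ltn; case: ltngtP.
rewrite exchange_big; apply: eq_bigr => l _.
rewrite ltnNge (ltnW ij) /= -mulr_sumr (H2 (i, l) (M - l)%N) //; last first.
  by have := ltn_ord l; rewrite /M; lia.
(* The binomial of [m] over [l] vanishes for m < l, so the first [l] terms drop out. *)
have -> : M = (l + (M - l))%N by have := ltn_ord l; rewrite /M; lia.
rewrite big_split_ord /= big1 => [|m _]; last first.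
  by rewrite gbin_bin bin_small // !mulr0 mul0r.
rewrite add0r addKn !mulr_sumr; apply: eq_bigr => m _.
rewrite gbin_add -addnA (_ : l%:Z - (l + m)%N%:Z = - m%:Z); last by lia.
rewrite (_ : - (k.+1 + l)%N%:Z = - k.+1%:Z - l%:Z); last by lia.
by rewrite !exprD; ring.
Qed.

End Recursion.

End Correlator.

(** * Rationality and values of the correlators *)

Section CorrelatorValue.
Variables (C : numClosedFieldType) (V : voa C) (h : 'I_2 -> V).
Hypothesis V_heis : heisenberg2 h.
Variable B : V -> V -> C.
Hypothesis B_LiZ : LiZ_metric B.
Variables (n : nat) (y : 'I_n -> C).
Hypothesis inj_y : injective y.
Implicit Types (v : 'I_n -> V) (e : 'I_n -> int).

Lemma corr_series_lin v j c u u' e : corr_series B (setv v j (c *: u + u')) e =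
  c * corr_series B (setv v j u) e + corr_series B (setv v j u') e.
Proof.
have [s1 [s2 [sE m1 m2]]] := enum_ord_split j.
rewrite !(corr_series_split _ _ _ sE) !setv_eq.
have eqs s w x : j \notin s -> corr_seq s (setv v j w) e x = corr_seq s v e x.
  move=> js; apply: eq_corr_seq => // t ts; rewrite setv_neq //.
  by apply: contraNneq js => <-.
rewrite !eqs ?m1 ?m2 ?ltnn // mode_linearl corr_seq_lin.
by rewrite (BDr B_LiZ) (BZr B_LiZ).
Qed.

Lemma corr_series_vac e : corr_series B (fun=> vac) e = [forall i, e i == 0]%:R.
Proof.
have cs s : corr_seq s (fun=> vac : V) e vac = if all (fun i => e i == 0) s then vac else 0.
  elim: s => //= i s ->; case: (all _ s); rewrite ?andbF ?mode0r // andbT.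
  by rewrite mode_vac (_ : (- e i - 1 == -1) = (e i == 0)) //; lia.
rewrite /corr_series cs; have -> : all (fun i => e i == 0) (enum 'I_n) = [forall i, e i == 0].
  apply/allP/forallP => [H i|H i _]; last exact: H.
  by apply: H; rewrite mem_enum.
by case: ifP => _; rewrite ?(B_vac B_LiZ) // (B0r B_LiZ).
Qed.

(** The default 0 is never reached, by [rationalT]; for vectors and points read off a list this is
    [corr] by conversion. *)
Definition corr_value v : C := xget 0 [set z | has_value y (corr_series B v) z].
Definition rational v : Prop := exists z, has_value y (corr_series B v) z.

Lemma corr_valueP v : rational v -> has_value y (corr_series B v) (corr_value v).
Proof. by move=> [z vz]; rewrite /corr_value; case: xgetP => [z' _ //|/(_ z)]. Qed.

Lemma corr_value_eq v z : has_value y (corr_series B v) z -> corr_value v = z.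
Proof. by move=> vz; apply: (has_value_unique inj_y _ vz); apply: corr_valueP; exists z. Qed.

Lemma rational_lin v j c u u' : rational (setv v j u) -> rational (setv v j u') ->
  rational (setv v j (c *: u + u')).
Proof.
move=> [z uz] [z' uz']; exists (c * z + z').
have -> : corr_series B (setv v j (c *: u + u')) = fun e =>
    c * corr_series B (setv v j u) e + corr_series B (setv v j u') e.
  by apply/funext => e; exact: corr_series_lin.
exact: has_value_lin.
Qed.

Lemma rational_zero v j : v j = 0 -> has_value y (corr_series B v) 0.
Proof.
move=> vj; have -> : corr_series B v = fun=> 0; last exact: has_value0.
apply/funext => e; have [s1 [s2 [sE _ _]]] := enum_ord_split j.
by rewrite (corr_series_split _ _ _ sE) vj mode0l corr_seq0 (B0r B_LiZ).
Qed.

Lemma has_value_rec v j w (a : 'I_2) (k L : nat) :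
  (forall i (l : nat), (L <= l)%N -> mode (h a) l%:Z (setv v j w i) = 0) ->
  (forall i l, i != j ->
     rational (setv (setv v j w) i (mode (h a) l%:Z (setv v j w i)))) ->
  has_value y (corr_series B (setv v j (mode (h a) (- k.+1%:Z) w)))
   (- \sum_(i < n | i != j) \sum_(l < L) gbin C (- k.+1%:Z) l *
      (corr_value (setv (setv v j w) i (mode (h a) l%:Z (setv v j w i)))
       / (y i - y j) ^+ (k.+1 + l))).
Proof.
move=> WL good.
rewrite (funext (@corr_series_rec _ _ _ V_heis _ B_LiZ _ v j w a k L WL)).
apply: has_value_opp => //; apply: has_value_sum => // i ij; apply: has_value_sum => // l _.
apply: has_value_scale => //; have gv := corr_valueP (good i l ij).
case: ltnP => [lt|ge].
  apply: has_value_expand => //; exact: bounded_corr_series.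
have lt : (j < i)%N by rewrite ltn_neqAle eq_sym ij.
(* The sign in the recursion accounts for replacing y_i - y_j by y_j - y_i, the difference expanded
   when [j] stands to the left. *)
rewrite -(opprB (y j)) (exprNn (y j - y i)) invfM invr_sign mulrCA.
apply: has_value_scale => //; apply: has_value_expand => //; first by rewrite eq_sym.
exact: bounded_corr_series.
Qed.

(** Outer induction on the total Fock level, then on the list [s] of punctures that may still hold
    something other than the vacuum, then on the Fock structure of the vector at its head [j]. The
    recursion takes a creation operator away from [j] and an annihilation operator lowers another
    level, so the outer hypothesis applies. *)
Lemma rationalT v : rational v.
Proof.
have [lev levP] : exists lev, forall i, fock h (lev i) (v i).
  by have /choice[lev H] := fun i => fockT V_heis (v i); exists lev.
have [N] : exists N, (\sum_i lev i < N)%N by exists (\sum_i lev i).+1.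
elim: N v lev levP => // N IHN v lev levP levN.
suff Q (s : seq 'I_n) : forall v lev, (forall i, fock h (lev i) (v i)) ->
    (\sum_i lev i < N.+1)%N -> (forall i, i \notin s -> v i = vac) -> rational v.
  by apply: (Q (enum 'I_n) v lev) => // i; rewrite mem_enum.
elim: s => [|j s IHs] {}v {}lev {}levP {}levN vvac.
  have -> : v = fun=> vac by apply/funext => i; apply: vvac.
  exists 1; have -> : corr_series B (fun=> vac) = fun e => [forall i, e i == 0]%:R.
    by apply/funext => e; exact: corr_series_vac.
  exact: has_value_one.
rewrite -(setv_id v j).
have : (lev j + \sum_(i | i != j) lev i < N.+1)%N by move: levN; rewrite (bigD1 j).
have : forall i, i != j -> fock h (lev i) (v i) by [].
have : forall i, i != j -> i \notin s -> v i = vac.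
  by move=> i ij si; apply: vvac; rewrite inE negb_or ij.
move: (levP j); move: (lev j) (v j) => m u Fu {vvac levP levN} vvac levP levN.
elim: Fu levN => {m u} [m|m c u u' _ IHu _ IHu'|m a k u Fu _] levN.
- apply: (IHs _ (fun i => if i == j then 0%N else lev i)).
  + move=> i; case: eqP => [->|/eqP ij]; first by rewrite setv_eq; apply: fock_vac.
    by rewrite setv_neq //; apply: levP.
  + rewrite (bigD1 j) //= eqxx add0n; apply: leq_ltn_trans levN.
    apply: leq_trans (leq_addl _ _); apply: leq_sum => i ij.
    by rewrite (negPf ij).
  move=> i si; case: (eqVneq i j) => [->|ij]; first by rewrite setv_eq.
  by rewrite setv_neq //; apply: vvac.
- by apply: rational_lin; auto.
have [L HL] : exists L : nat, forall i M, (L <= M)%N ->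
    mode (h a) M%:Z (setv v j u i) = 0.
  apply: eventually_fin => i; have [M HM] := mode_small (h a) (setv v j u i).
  by exists M => l lM; apply: HM.
eexists; apply: (@has_value_rec _ _ _ _ _ L) => [i l|i l ij]; first exact: HL.
(* At level 0 the vector is killed by the annihilation operator, so this correlator is 0. *)
case liE: (lev i) => [|li].
  exists 0; apply: (rational_zero (j := i)); rewrite setv_eq setv_neq //.
  by have := fock_ann V_heis a l (levP i ij); rewrite liE.
apply: (IHN _ (fun t => if t == i then li else if t == j then m else lev t)).
  move=> t; case: eqP => [->|/eqP ti].
    rewrite setv_eq setv_neq //.
    by have := fock_ann V_heis a l (levP i ij); rewrite liE.
  rewrite setv_neq //; case: eqP => [->|/eqP tj]; first by rewrite setv_eq.
  by rewrite setv_neq //; apply: levP.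
rewrite (bigD1 j) //= eq_sym (negPf ij) eqxx; rewrite ltnS in levN.
apply: leq_trans levN; rewrite addSn ltnS leq_add2l.
by apply: leq_sum => t tj; rewrite (negPf tj); case: eqP => [->|//]; rewrite liE.
Qed.

Lemma corr_value_lin v j c u u' :
  corr_value (setv v j (c *: u + u')) = c * corr_value (setv v j u) + corr_value (setv v j u').
Proof.
apply: corr_value_eq; have -> : corr_series B (setv v j (c *: u + u')) = fun e =>
    c * corr_series B (setv v j u) e + corr_series B (setv v j u') e.
  by apply/funext => e; exact: corr_series_lin.
by apply: has_value_lin => //; apply: corr_valueP; apply: rationalT.
Qed.

Lemma corr_value_vac : corr_value (fun=> vac) = 1.
Proof.
apply: corr_value_eq; have -> : corr_series B (fun=> vac) = fun e => [forall i, e i == 0]%:R.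
  by apply/funext => e; exact: corr_series_vac.
exact: has_value_one.
Qed.

Lemma corr_value_rec v j (a : 'I_2) (k L : nat) :
  (forall i (l : nat), (L <= l)%N -> mode (h a) l%:Z (v i) = 0) ->
  corr_value (setv v j (mode (h a) (- k.+1%:Z) (v j))) =
   - \sum_(i < n | i != j) \sum_(l < L) gbin C (- k.+1%:Z) l *
      (corr_value (setv v i (mode (h a) l%:Z (v i))) / (y i - y j) ^+ (k.+1 + l)).
Proof.
move=> vL; apply: corr_value_eq; have := @has_value_rec v j (v j) a k L.
by rewrite setv_id; apply => // *; apply: rationalT.
Qed.

End CorrelatorValue.

Lemma corrE (C : numClosedFieldType) (V : voa C) (B : V -> V -> C)
    (s : seq (V * C)) :
  corr B s = corr_value B (fun i => (tnth (in_tuple s) i).2) (fun i => (tnth (in_tuple s) i).1).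
Proof. by []. Qed.

Lemma corr_castE (C : numClosedFieldType) (V : voa C) (B : V -> V -> C)
    (s : seq (V * C)) (n : nat) (sn : size s = n) :
  corr B s = corr_value B (fun i => (tnth (in_tuple s) (cast_ord (esym sn) i)).2)
                  (fun i => (tnth (in_tuple s) (cast_ord (esym sn) i)).1).
Proof.
case: n / sn => /=; rewrite corrE; congr corr_value; apply/funext => i;
  by congr (tnth _ _).1 || congr (tnth _ _).2; apply: val_inj.
Qed.

Section SlabCorrelator.
Variables (C : numClosedFieldType) (V : voa C) (h : 'I_2 -> V).
Hypothesis V_heis : heisenberg2 h.
Variable B : V -> V -> C.
Hypothesis B_LiZ : LiZ_metric B.
Variables (g : nat) (w : slab g -> C).
Hypothesis inj_w : injective w.
Implicit Types (v : slab g -> V) (x z : slab g).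

(** The order of the punctures in [partition_function]: within a handle, w_{-a} precedes w_a. *)
Definition slab_seq : seq (slab g) :=
  flatten [seq [:: (a, false); (a, true)] | a <- enum 'I_g].

Lemma mem_slab_seq x : x \in slab_seq.
Proof.
apply/flattenP; exists [:: (x.1, false); (x.1, true)].
  by apply: map_f; rewrite mem_enum.
by case: x => a [] /=; rewrite !inE eqxx ?orbT.
Qed.

Lemma slab_seq_uniq : uniq slab_seq.
Proof.
rewrite /slab_seq; elim: (enum 'I_g) (enum_uniq 'I_g) => //= a s IH /andP[as_ us].
have notin (c : bool) : (a, c) \notin flatten [seq [:: (b, false); (b, true)] | b <- s].
  apply/flattenP => -[_ /mapP[b bs ->]]; rewrite !inE !xpair_eqE.
  move=> ab; have /eqP ab' : a == b by case/orP: ab => /andP[].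
  by rewrite ab' bs in as_.
by rewrite inE negb_or !notin IH // xpair_eqE andbF.
Qed.

Let n := size slab_seq.
Let pos (i : 'I_n) : slab g := tnth (in_tuple slab_seq) i.

Let pos_inj : injective pos.
Proof.
move=> i j; rewrite /pos !(tnth_nth (pos i)) /= => /eqP.
by rewrite nth_uniq ?slab_seq_uniq // => /eqP /val_inj.
Qed.

Definition slab_corr v : C := corr_value B (w \o pos) (v \o pos).

Lemma slab_corrE v : slab_corr v = corr B [seq (v x, w x) | x <- slab_seq].
Proof.
rewrite (corr_castE _ (size_map _ _)).
have E i : tnth (in_tuple [seq (v x, w x) | x <- slab_seq])
    (cast_ord (esym (size_map (fun x => (v x, w x)) slab_seq)) i) = (v (pos i), w (pos i)).
  by rewrite /pos (tnth_nth (v (pos i), w (pos i))) (tnth_nth (pos i)) /= (nth_map (pos i)).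
by congr corr_value; apply/funext => i /=; rewrite E.
Qed.

Let pos_bij : bijective pos.
Proof.
have ix x : (index x slab_seq < n)%N by rewrite index_mem mem_slab_seq.
exists (fun x => Ordinal (ix x)) => x.
  apply: pos_inj; rewrite /pos !(tnth_nth (pos x)) /= nth_index // mem_slab_seq //.
by rewrite /pos (tnth_nth x) /= nth_index // mem_slab_seq.
Qed.

Let setv_pos v i u : setv v (pos i) u \o pos = setv (v \o pos) i u.
Proof. by apply/funext => t; rewrite /setv /= (inj_eq pos_inj). Qed.

Let wpos_inj : injective (w \o pos).
Proof. exact: inj_comp inj_w pos_inj. Qed.

Lemma slab_corr_lin v x c u u' :
  slab_corr (setv v x (c *: u + u')) = c * slab_corr (setv v x u) + slab_corr (setv v x u').
Proof.
have [q qK pK] := pos_bij; rewrite -[x]pK /slab_corr !setv_pos.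
exact: (corr_value_lin V_heis B_LiZ).
Qed.

Lemma slab_corr_vac : slab_corr (fun=> vac) = 1.
Proof. exact: (corr_value_vac B_LiZ). Qed.

(** As [h(0) = 0], only the modes from 1 on survive; these are the modes that index A. *)
Lemma slab_corr_rec v x (a : 'I_2) (k L : nat) :
  (forall z (l : nat), (L < l)%N -> mode (h a) l%:Z (v z) = 0) ->
  slab_corr (setv v x (mode (h a) (- k.+1%:Z) (v x))) =
  - \sum_(z | z != x) \sum_(l < L) gbin C (- k.+1%:Z) l.+1 *
     (slab_corr (setv v z (mode (h a) l.+1%:Z (v z))) / (w z - w x) ^+ (k.+1 + l.+1)).
Proof.
move=> vL; have [q qK pK] := pos_bij; rewrite -[x]pK /slab_corr !setv_pos.
rewrite (@corr_value_rec _ _ _ V_heis _ B_LiZ _ _ wpos_inj (v \o pos) (q x) a k L.+1); last first.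
  by move=> i l Ll; apply: vL.
rewrite (reindex pos) /=; last exact: onW_bij.
congr (- _); apply: eq_big => [i|i _]; first by rewrite (inj_eq pos_inj).
rewrite big_ord_recl /= (heis_mode0 V_heis) (_ : corr_value _ _ _ = 0) ?mul0r ?mulr0 ?add0r.
  by apply: eq_bigr => l _; rewrite setv_pos.
by apply: (corr_value_eq wpos_inj); apply: (@rational_zero _ _ _ B_LiZ _ _ _ i); rewrite setv_eq.
Qed.

End SlabCorrelator.

(** * Sewing *)

Section HomogeneousBasis.
Variables (C : numClosedFieldType) (V : voa C) (h : 'I_2 -> V).
Hypothesis V_heis : heisenberg2 h.
Variable B : V -> V -> C.
Hypothesis B_LiZ : LiZ_metric B.
Variables (I : choiceType) (b bd : I -> V) (wt : I -> nat).
Hypothesis b_basis : homog_basis b wt.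
Hypothesis bd_dual : dual_basis B b bd.

Lemma b_wt i : vir 0 (b i) = (wt i)%:R *: b i.
Proof. by case: b_basis => H _ _; apply: H. Qed.

Lemma basis_orth u : (forall j, B u (b j) = 0) -> u = 0.
Proof.
move=> u0; apply: (B_nondeg B_LiZ) => v; case: b_basis => _ _ /(_ v) [s [c ->]].
by rewrite (B_sumr B_LiZ) big1 // => i _; rewrite (BZr B_LiZ) u0 mulr0.
Qed.

(** Eigenvectors of the self-adjoint L(0) for distinct eigenvalues are orthogonal. An arbitrary
    scalar [c] also covers negative weights, which are then excluded by [weight_eq0]. *)
Lemma weight_orth (c : C) (u : V) j : vir 0 u = c *: u -> c != (wt j)%:R -> B u (b j) = 0.
Proof.
move=> uc cj; have := vir0_adj V_heis B_LiZ u (b j).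
rewrite uc b_wt (BZl B_LiZ) (BZr B_LiZ) => /eqP.
by rewrite -subr_eq0 -mulrBl mulf_eq0 subr_eq0 (negPf cj) => /eqP.
Qed.

Lemma weight_eq0 (c : C) (u : V) : vir 0 u = c *: u -> (forall n : nat, c != n%:R) -> u = 0.
Proof. by move=> uc cn; apply: basis_orth => j; apply: weight_orth uc _. Qed.

(** Both sides pair equally with every [b j], because L(0) is self-adjoint. *)
Lemma bd_wt i : vir 0 (bd i) = (wt i)%:R *: bd i.
Proof.
apply/eqP; rewrite -subr_eq0; apply/eqP/basis_orth => j.
rewrite (BBl B_LiZ) (BZl B_LiZ) (vir0_adj V_heis B_LiZ) b_wt (BZr B_LiZ) bd_dual.
by case: eqP => [->|_]; rewrite ?subrr // !mulr0 subrr.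
Qed.

(** More basis vectors of weight [k] than the spanning list of [grading_fin] has members would give
    the matrix of their coefficients a nonzero left kernel, against linear independence. *)
Lemma weight_finite (k : nat) : exists N : nat, forall s : seq I, uniq s ->
  (forall i, i \in s -> wt i = k) -> (size s <= N)%N.
Proof.
have [s sP] := grading_fin V k; exists (size s) => r ur rk.
have /choice[c cP] : forall i, exists c : nat -> C, i \in r ->
    b i = \sum_(l < size s) c l *: s`_l.
  move=> i; case: (boolP (i \in r)) => [ir|_]; last by exists (fun=> 0).
  have [|c cE] := sP (b i); last by exists c.
  by have := b_wt i; rewrite rk.
rewrite leqNgt; apply/negP => lt.
case: r ur rk cP lt => [//|i0 r0] ; set r := i0 :: r0 => ur rk cP lt.
pose A : 'M[C]_(size r, size s) := \matrix_(t, l) c (nth i0 r t) l.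
have : kermx A != 0.
  rewrite -mxrank_eq0 mxrank_ker subn_eq0 -ltnNge.
  exact: leq_ltn_trans (rank_leq_col A) lt.
case/rowV0Pn => x /sub_kermxP xA; apply/negP; rewrite negbK.
have idx i : i \in r -> (index i r < size r)%N by rewrite index_mem.
pose z i : C := if insub (index i r) is Some t then x ord0 t else 0.
have zE (t : 'I_(size r)) : z (nth i0 r t) = x ord0 t.
  rewrite /z index_uniq // insubT // => lt_t.
  by congr (x _ _); apply: val_inj.
case: b_basis => _ /(_ r z ur) free _; apply/eqP/rowP => t; rewrite mxE -zE.
apply: free; last exact: mem_nth.
rewrite (big_nth i0) big_mkord.
under eq_bigr => l _ do rewrite cP ?mem_nth // zE scaler_sumr.
rewrite exchange_big big1 //= => l _; have := congr1 (fun M : 'rV_ _ => M ord0 l) xA.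
rewrite !mxE => xAl; under eq_bigr => t' _ do rewrite scalerA.
rewrite -scaler_suml (_ : \sum_t' _ = 0) ?scale0r // -[RHS]xAl.
by apply: eq_bigr => t' _; rewrite mxE.
Qed.

(** A duplicate-free list of indices of weight [k] of maximal length must contain them all. *)
Lemma weight_enum (k : nat) : exists s : seq I, uniq s /\ forall i, (i \in s) = (wt i == k).
Proof.
have [N HN] := weight_finite k.
pose P m := `[< exists s : seq I, [/\ uniq s, forall i, i \in s -> wt i = k & size s = m] >].
have P0 : exists m, P m by exists 0%N; apply/asboolP; exists [::].
have PN m : P m -> (m <= N)%N by move/asboolP => [s [us sk <-]]; apply: HN.
have [m /asboolP[s [us sk sm]] mmax] := ex_maxnP P0 PN.
exists s; split=> // i; apply/idP/eqP => [|ik]; first exact: sk.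
apply/negPn/negP => nis; have : (m.+1 <= m)%N; last by rewrite ltnn.
apply: mmax; apply/asboolP; exists (i :: s); split; rewrite /= ?sm ?nis //.
by move=> j; rewrite inE => /orP[/eqP ->|/sk].
Qed.

Lemma low_weight_enum (d : nat) : exists s : seq I, forall i, (i \in s) = (wt i < d)%N.
Proof.
elim: d => [|d [s sP]]; first by exists [::].
have [r [_ rP]] := weight_enum d; exists (r ++ s) => i.
by rewrite mem_cat sP rP ltnS [RHS]leq_eqVlt.
Qed.

Section Complete.
Variables (T : finType) (eb : T -> I).
Hypothesis inj_eb : injective eb.

Lemma complete_bd v : (forall j, (forall t, j <> eb t) -> B v (b j) = 0) ->
  v = \sum_t B v (b (eb t)) *: bd (eb t).
Proof.
move=> v0; apply/eqP; rewrite -subr_eq0; apply/eqP/basis_orth => j.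
rewrite (BBl B_LiZ) (B_suml B_LiZ).
under eq_bigr => t _ do rewrite (BZl B_LiZ) bd_dual.
have [[t ->]|nj] := pselect (exists t, j = eb t).
  rewrite (sum_only (t0 := t)) ?eqxx ?mulr1 ?subrr // => t' ne.
  by rewrite (inj_eq inj_eb) (negPf ne) mulr0.
rewrite v0 => [|t tj]; last by apply: nj; exists t.
rewrite big1 ?subrr // => t _; case: eqP => [tj|]; rewrite ?mulr0 //.
by case: nj; exists t.
Qed.

End Complete.

(** Every vector is a sum of homogeneous ones, and a vector of weight [k] is orthogonal to all [b j]
    of other weights, hence a finite combination of the [bd j] by [complete_bd]. *)
Lemma dual_orth u : (forall j, B (bd j) u = 0) -> u = 0.
Proof.
move=> u0; apply: (B_nondeg B_LiZ) => v; rewrite (B_sym B_LiZ).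
have [N [x [xk ->]]] := grading v; rewrite (B_suml B_LiZ) big1 // => k _.
have [s sP] := low_weight_enum k.+1.
rewrite (@complete_bd (seq_sub s) val val_inj (x k)) => [|j nj].
  by rewrite (B_suml B_LiZ) big1 // => t _; rewrite (BZl B_LiZ) u0 mulr0.
apply: (@weight_orth k%:R); first exact: xk.
rewrite eqr_nat; apply/eqP => kj.
have js : j \in s by rewrite sP -kj.
by apply: (nj (SeqSub js)).
Qed.

Lemma complete_b (T : finType) (eb : T -> I) (inj_eb : injective eb) v :
  (forall j, (forall t, j <> eb t) -> B (bd j) v = 0) ->
  v = \sum_t B (bd (eb t)) v *: b (eb t).
Proof.
move=> v0; apply/eqP; rewrite -subr_eq0; apply/eqP/dual_orth => j.
rewrite (B_sym B_LiZ) (BBl B_LiZ) (B_suml B_LiZ).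
under eq_bigr => t _ do rewrite (BZl B_LiZ) (B_sym B_LiZ (b _)) bd_dual.
rewrite (B_sym B_LiZ v).
have [[t ->]|nj] := pselect (exists t, j = eb t).
  rewrite (sum_only (t0 := t)) ?eqxx ?mulr1 ?subrr // => t' ne.
  by rewrite eq_sym (inj_eq inj_eb) (negPf ne) mulr0.
rewrite v0 => [|t tj]; last by apply: nj; exists t.
rewrite big1 ?subrr // => t _; case: eqP => [tj|]; rewrite ?mulr0 //.
by case: nj; exists t.
Qed.

(** Annihilation operators take [x] to negative weight, hence to 0. So the difference of the two
    sides is orthogonal to the vacuum and to all h(-k)u, which exhaust V by [heis_ind]. *)
Lemma weight0_vac (x : V) : vir 0 x = 0 -> x = B x vac *: vac.
Proof.
move=> x0; apply/eqP; rewrite -subr_eq0; apply/eqP/(B_nondeg B_LiZ) => u.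
rewrite (B_sym B_LiZ); elim/(heis_ind V_heis): u => [|c u v IHu IHv|i k u _].
- by rewrite (B_sym B_LiZ) (BBl B_LiZ) (BZl B_LiZ) (B_vac B_LiZ) mulr1 subrr.
- by rewrite (B_linl B_LiZ) IHu IHv mulr0 addr0.
rewrite (heis_adj V_heis B_LiZ) opprK modeBr modeZr creation0 // scaler0 subr0.
rewrite (_ : mode _ _ x = 0) ?(B0r B_LiZ) ?oppr0 //.
apply: (@weight_eq0 (- k.+1%:R)).
  by rewrite (vir0_heis_comm V_heis) x0 mode0r sub0r scaleNr.
move=> m; rewrite -subr_eq0 -opprD oppr_eq0 -natrD pnatr_eq0 addSn //.
Qed.

End HomogeneousBasis.

Definition multilinear_form (C : numClosedFieldType) (V : lmodType C) (X : eqType)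
    (Psi : (X -> V) -> C) : Prop :=
  forall v x c u u', Psi (setv v x (c *: u + u')) =
    c * Psi (setv v x u) + Psi (setv v x u').

Section MultilinearForm.
Variables (C : numClosedFieldType) (V : voa C) (X : eqType).
Variable Psi : (X -> V) -> C.
Hypothesis Psi_lin : multilinear_form Psi.
Implicit Types (v : X -> V) (x : X).

Lemma mlin0 v x : Psi (setv v x 0) = 0.
Proof.
have := Psi_lin v x 1 0 0; rewrite scaler0 addr0 mul1r => E.
by apply: (addrI (Psi (setv v x 0))); rewrite -E addr0.
Qed.
Lemma mlinZ v x c u : Psi (setv v x (c *: u)) = c * Psi (setv v x u).
Proof. by rewrite -[c *: u]addr0 Psi_lin mlin0 addr0. Qed.
Lemma mlinD v x u u' :
  Psi (setv v x (u + u')) = Psi (setv v x u) + Psi (setv v x u').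
Proof. by rewrite -[u]scale1r Psi_lin mul1r scale1r. Qed.
Lemma mlin_sum v x (T : Type) (r : seq T) (P : pred T) (F : T -> V) :
  Psi (setv v x (\sum_(t <- r | P t) F t)) =
  \sum_(t <- r | P t) Psi (setv v x (F t)).
Proof.
exact: (big_morph (fun u => Psi (setv v x u)) (mlinD v x) (mlin0 v x)).
Qed.

Lemma mlin_mode x u k :
  multilinear_form (fun v => Psi (setv v x (mode u k (v x)))).
Proof.
move=> v y c u1 u2; have [->|yx] := eqVneq y x.
  by rewrite !setv_eq !setv_setv mode_linearr Psi_lin.
by rewrite !setv_neq 1?eq_sym // ![setv (setv v y _) x _]setvC // Psi_lin.
Qed.

End MultilinearForm.

Section Sewing.
Variables (C : numClosedFieldType) (V : voa C) (h : 'I_2 -> V).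
Hypothesis V_heis : heisenberg2 h.
Variable B : V -> V -> C.
Hypothesis B_LiZ : LiZ_metric B.
Variables (I : choiceType) (b bd : I -> V) (wt : I -> nat).
Hypothesis b_basis : homog_basis b wt.
Hypothesis bd_dual : dual_basis B b bd.
Variable g : nat.

(** The vector sewn in at the end of sign [c] of a handle; the sign as an argument lets both ends be
    treated at once. *)
Definition bs (c : bool) (i : I) : V := if c then b i else bd i.

Lemma bs_wt c i : vir 0 (bs c i) = (wt i)%:R *: bs c i.
Proof.
by case: c; [apply: (b_wt b_basis)|apply: (bd_wt V_heis B_LiZ b_basis bd_dual)].
Qed.

Lemma bs_orth (l : C) (u : V) c j :
  vir 0 u = l *: u -> l != (wt j)%:R -> B (bs c j) u = 0.
Proof.
move=> uc cj; have := vir0_adj V_heis B_LiZ (bs c j) u.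
rewrite uc bs_wt (BZl B_LiZ) (BZr B_LiZ) => /eqP.
by rewrite eq_sym -subr_eq0 -mulrBl mulf_eq0 subr_eq0 (negPf cj) => /eqP.
Qed.

Lemma heis_bs_wt (a : 'I_2) c i (k : int) :
  vir 0 (mode (h a) k (bs c i)) = ((wt i)%:Z - k)%:~R *: mode (h a) k (bs c i).
Proof.
rewrite (vir0_heis_comm V_heis) bs_wt modeZr -scalerBl; congr (_ *: _).
by rewrite rmorphB.
Qed.

Lemma heis_bs_eq0 (a : 'I_2) c i (k : nat) : (wt i < k)%N -> mode (h a) k (bs c i) = 0.
Proof.
move=> ik; apply: (weight_eq0 V_heis B_LiZ b_basis); first exact: heis_bs_wt.
move=> m; rewrite -[m%:R]/(m%:Z%:~R) eqr_int; lia.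
Qed.

Variable d : nat.
Variables (T : finType) (eb : T -> I).
Hypothesis inj_eb : injective eb.
Hypothesis ebP : forall i, (wt i < d)%N <-> exists t, i = eb t.

Lemma wt_eb t : (wt (eb t) < d)%N. Proof. by apply/ebP; exists t. Qed.
Lemma wt_not_eb i : (forall t, i <> eb t) -> (d <= wt i)%N.
Proof. by move=> ni; rewrite leqNgt; apply/negP => /ebP [t it]; apply: (ni t). Qed.

(** Basis vectors of weight other than [n], among them all those outside the truncation, are
    orthogonal to [u]. The weight is an integer because annihilation may lead below 0. *)
Lemma complete_bs c (n : int) (u : V) : n < d%:Z -> vir 0 u = n%:~R *: u ->
  u = \sum_t B (bs (~~ c) (eb t)) u *: bs c (eb t).
Proof.
move=> nd un; have orth e j : (forall t, j <> eb t) -> B (bs e j) u = 0.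
  move=> nj; apply: bs_orth un _; rewrite -[_%:R]/((wt j)%:Z%:~R) eqr_int.
  by have := wt_not_eb nj; lia.
case: c => /=.
  by apply: (complete_b V_heis B_LiZ b_basis bd_dual) => // j; apply: (orth false).
under eq_bigr => t _ do rewrite (B_sym B_LiZ).
apply: (complete_bd B_LiZ b_basis bd_dual) => // j nj.
by rewrite (B_sym B_LiZ); apply: (orth true).
Qed.

Definition vb (beta : {ffun 'I_g -> T}) : slab g -> V :=
  fun x => bs x.2 (eb (beta x.1)).

Definition rhow (beta : {ffun 'I_g -> T}) : fps g C :=
  \prod_(a < g) rho C a ^+ wt (eb (beta a)).

(** A basis vector of weight n carries rho^n, so cutting the sums at weight [d] loses nothing modulo
    order [d]. *)
Definition sew (Psi : (slab g -> V) -> C) : fps g C :=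
  \sum_beta rhow beta * fpsC g (Psi (vb beta)).

Definition fupd (beta : {ffun 'I_g -> T}) (a : 'I_g) (t : T) : {ffun 'I_g -> T} :=
  [ffun c => if c == a then t else beta c].

Lemma vb_fupd (beta : {ffun 'I_g -> T}) (x : slab g) t :
  setv (vb (fupd beta x.1 t)) (sneg x) (bs (~~ x.2) (eb (beta x.1))) =
  setv (vb beta) x (bs x.2 (eb t)).
Proof.
case: x => a c; apply/funext => -[a' c']; rewrite /setv /vb /sneg /= !ffunE !xpair_eqE.
by case: eqP => [->|] //=; case: c; case: c'.
Qed.

(** The weight that annihilation removes from a handle reappears as a power of rho. *)
Lemma rhow_fupd (beta : {ffun 'I_g -> T}) a t (l : nat) : (wt (eb t) + l = wt (eb (beta a)))%N ->
  rho C a ^+ l * rhow (fupd beta a t) = rhow beta.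
Proof.
move=> wl; rewrite /rhow (bigD1 a) //= [RHS](bigD1 a) //= ffunE eqxx mulrA -exprD.
rewrite addnC wl; congr (_ * _); apply: eq_bigr => c ca.
by rewrite ffunE (negPf ca).
Qed.

Lemma eqd_rho_rhow (beta : {ffun 'I_g -> T}) a (l : nat) : (d <= wt (eb (beta a)) + l)%N ->
  eqd d (rho C a ^+ l * rhow beta) 0.
Proof.
move=> le; rewrite /rhow (bigD1 a) //= mulrA -exprD; apply: eqd0Ml.
by rewrite /rho -exprM; apply: eqd_fpsXn; lia.
Qed.

(* Both sides are expanded in the bases; exchanging the basis vector of the sum
   at handle x.1 with the one of the expansion matches them term by term. *)
Lemma sew_contract (Psi : (slab g -> V) -> C) (a : 'I_2) (x : slab g) (l : nat) :
  multilinear_form Psi ->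
  eqd d (sew (fun v => Psi (setv v x (mode (h a) l.+1%:Z (v x)))))
        (- (rho C x.1 ^+ l.+1 *
            sew (fun v => Psi (setv v (sneg x) (mode (h a) (- l.+1%:Z) (v (sneg x))))))).
Proof.
move=> Psi_lin.
pose F (p : {ffun 'I_g -> T} * T) : fps g C := rhow p.1 *
  fpsC g (B (bs (~~ x.2) (eb p.2)) (mode (h a) l.+1%:Z (bs x.2 (eb (p.1 x.1)))) *
          Psi (setv (vb p.1) x (bs x.2 (eb p.2)))).
have -> : sew (fun v => Psi (setv v x (mode (h a) l.+1%:Z (v x)))) = \sum_p F p.
  rewrite -(pair_bigA _ (fun beta t => F (beta, t))); apply: eq_bigr => beta _ /=.
  rewrite /F /= -mulr_sumr -fpsC_sum; congr (_ * fpsC g _).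
  rewrite [vb beta x]/(bs x.2 (eb (beta x.1))).
  rewrite [mode _ _ _ in LHS](@complete_bs x.2 _ _ _ (heis_bs_wt _ _ _ _)); last first.
    by have := wt_eb (beta x.1); lia.
  by rewrite mlin_sum //; apply: eq_bigr => t _; rewrite mlinZ.
pose G (p : {ffun 'I_g -> T} * T) : fps g C := - (rho C x.1 ^+ l.+1 * rhow p.1 *
  fpsC g (B (bs x.2 (eb p.2)) (mode (h a) (- l.+1%:Z) (bs (~~ x.2) (eb (p.1 x.1)))) *
          Psi (setv (vb p.1) (sneg x) (bs (~~ x.2) (eb p.2))))).
apply: (@eqd_trans _ _ _ (\sum_p G p)); last first.
  rewrite -(pair_bigA _ (fun beta t => G (beta, t))) /= /sew mulr_sumr -sumrN.
  apply: eqd_sum => beta _; rewrite /G /= sumrN; apply: eqdN.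
  rewrite -mulr_sumr mulrA.
  have [lt|le] := ltnP (wt (eb (beta x.1)) + l.+1) d; last first.
    apply: (@eqd_trans _ _ _ 0); first exact/eqd0Ml/eqd_rho_rhow.
    exact/eqd_sym/eqd0Ml/eqd_rho_rhow.
  apply: eqdM => //; rewrite -fpsC_sum.
  rewrite [vb beta (sneg x)]/(bs (~~ x.2) (eb (beta x.1))).
  rewrite [X in eqd d _ (fpsC g (Psi (setv _ _ X)))]
    (@complete_bs (~~ x.2) _ _ _ (heis_bs_wt _ _ _ _)); last by lia.
  by rewrite mlin_sum // negbK; under [X in eqd d _ (fpsC g X)]eq_bigr do rewrite mlinZ //.
pose sw (p : {ffun 'I_g -> T} * T) := (fupd p.1 x.1 p.2, p.1 x.1).
have swK : involutive sw.
  move=> [beta t]; rewrite /sw /= ffunE eqxx; congr (_, _).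
  by apply/ffunP => c; rewrite !ffunE; case: eqP => [->|].
rewrite [X in eqd d _ X](reindex_inj (inv_inj swK)) /=.
apply: eqd_sum => -[beta t] _; rewrite /F /G /sw /= ffunE eqxx vb_fupd.
have -> : B (bs x.2 (eb (beta x.1))) (mode (h a) (- l.+1%:Z) (bs (~~ x.2) (eb t))) =
    - B (bs (~~ x.2) (eb t)) (mode (h a) l.+1%:Z (bs x.2 (eb (beta x.1)))).
  by rewrite [in RHS](B_sym B_LiZ) (heis_adj V_heis B_LiZ) opprK.
rewrite mulNr fpsCN mulrN opprK.
have [E|ne] := eqVneq (wt (eb t) + l.+1)%N (wt (eb (beta x.1))).
  by rewrite rhow_fupd.
rewrite (bs_orth _ (heis_bs_wt _ _ _ _)) ?mul0r ?fpsC0 ?mulr0 //.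
by rewrite -[_%:R]/((wt (eb t))%:Z%:~R) eqr_int; lia.
Qed.

End Sewing.

(** * The recursion for sewn correlators of two creation operators *)

Section SewnCorrelator.
Variables (C : numClosedFieldType) (V : voa C) (h : 'I_2 -> V).
Hypothesis V_heis : heisenberg2 h.
Variable B : V -> V -> C.
Hypothesis B_LiZ : LiZ_metric B.
Variables (I : choiceType) (b bd : I -> V) (wt : I -> nat).
Hypothesis b_basis : homog_basis b wt.
Hypothesis bd_dual : dual_basis B b bd.
Variables (g : nat) (w : slab g -> C).
Hypothesis inj_w : injective w.
Variable d : nat.
Variables (T : finType) (eb : T -> I).
Hypothesis inj_eb : injective eb.
Hypothesis ebP : forall i, (wt i < d)%N <-> exists t, i = eb t.

Local Notation gm := (slab_corr B w).
Local Notation Sew := (sew b bd wt eb).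
Local Notation vb := (vb b bd eb).
Implicit Types (v : slab g -> V) (x y z : slab g * 'I_d) (a : 'I_2).

(** The second component of an index is the mode number minus one, so that ['I_d] covers the modes 1
    to d. *)
Definition cre a x v := setv v x.1 (mode (h a) (- x.2.+1%:Z) (v x.1)).
Definition ann a x v := setv v x.1 (mode (h a) x.2.+1%:Z (v x.1)).
Definition opp_idx x : slab g * 'I_d := (sneg x.1, x.2).

Lemma opp_idxK : involutive opp_idx.
Proof. by case=> -[c s] k; rewrite /opp_idx /sneg /= negbK. Qed.

Lemma gm_mlin : multilinear_form gm.
Proof. move=> v s c u u'; exact: (slab_corr_lin V_heis B_LiZ inj_w). Qed.

(** [d] modes suffice, since a mode above the weight n < d leads to negative weight. *)
Lemma vir0_low (n : nat) (u : V) : (n < d)%N -> vir 0 u = n%:R *: u ->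
  vir 0 u = \sum_a \sum_(k < d) mode (h a) (- k.+1%:Z) (mode (h a) k.+1%:Z u).
Proof.
move=> nd un; have [M0 H] := conf_mode1 V_heis u.
rewrite /vir add0r (H (maxn M0 d)) ?leq_maxl //; apply: eq_bigr => a _.
rewrite (big_ord_widen _ (fun k => mode (h a) (- k.+1%:Z) (mode (h a) k.+1%:Z u)) (leq_maxr M0 d)).
rewrite [RHS]big_mkcond; apply: eq_bigr => k _; case: ltnP => // dk.
rewrite (_ : mode (h a) k.+1%:Z u = 0) ?mode0r //.
apply: (@weight_eq0 _ _ _ V_heis _ B_LiZ _ _ _ b_basis ((n%:Z - k.+1%:Z)%:~R)).
  rewrite (vir0_heis_comm V_heis) un modeZr -scalerBl; congr (_ *: _).
  by rewrite rmorphB.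
move=> m; rewrite -[m%:R]/(m%:Z%:~R) eqr_int; lia.
Qed.

(** The derivation counts powers of rho^(1/2), hence twice the weight at each handle: once for L(0)
    at either end. *)
Lemma euler_sew : euler (Sew gm) = \sum_a \sum_x Sew (fun v => gm (cre a x (ann a x v))).
Proof.
transitivity (\sum_beta \sum_a \sum_x
   rhow C wt eb beta * fpsC g (gm (cre a x (ann a x (vb beta))))); last first.
  rewrite exchange_big; apply: eq_bigr => a _.
  by rewrite exchange_big; apply: eq_bigr => x _.
rewrite /sew raddf_sum; apply: eq_bigr => beta _ /=.
under [RHS]eq_bigr => a _ do rewrite -mulr_sumr -fpsC_sum.
rewrite -mulr_sumr -fpsC_sum eulerM eulerC mulr0 addr0.
rewrite (@euler_prod _ _ _ _ _ (fun c => (2 * wt (eb (beta c)))%N)); last first.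
  by move=> c; rewrite /rho -exprM euler_fpsXn.
have -> : \sum_a \sum_x gm (cre a x (ann a x (vb beta))) =
    (\sum_c (2 * wt (eb (beta c))))%N%:R * gm (vb beta).
  transitivity (\sum_(s : slab g) (wt (eb (beta s.1)))%:R * gm (vb beta)); last first.
    rewrite -mulr_suml natr_sum; congr (_ * _).
    rewrite -(pair_bigA _ (fun c (e : bool) => (wt (eb (beta c)))%:R)) /=.
    by apply: eq_bigr => c _; rewrite big_bool /= -natrD addnn mul2n.
  under eq_bigr => a _.
    rewrite -(pair_bigA _ (fun s k => gm (cre a (s, k) (ann a (s, k) (vb beta))))) /=.
    over.
  rewrite exchange_big; apply: eq_bigr => s _.
  have wE := bs_wt V_heis B_LiZ b_basis bd_dual s.2 (eb (beta s.1)).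
  rewrite -{2}(setv_id (vb beta) s) -(mlinZ gm_mlin) -[in RHS]wE.
  rewrite (vir0_low (wt_eb ebP _) wE) (mlin_sum gm_mlin); apply: eq_bigr => a _.
  rewrite (mlin_sum gm_mlin); apply: eq_bigr => k _.
  by rewrite /cre /ann /= setv_eq setv_setv.
by rewrite fpsCM fpsC_nat -mulrA mulrCA.
Qed.

(* The coefficient with which Zhu recursion turns a creation operator at x into
   an annihilation operator at y. *)
Definition zhu x y : C := if y.1 == x.1 then 0 else
  - (gbin C (- x.2.+1%:Z) y.2.+1 / (w y.1 - w x.1) ^+ (x.2.+1 + y.2.+1)).

Lemma slab_corr_zhu a x v :
  (forall s (l : nat), (d < l)%N -> mode (h a) l%:Z (v s) = 0) ->
  gm (cre a x v) = \sum_y zhu x y * gm (ann a y v).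
Proof.
move=> vd; rewrite /cre (slab_corr_rec V_heis B_LiZ inj_w _ _ vd).
rewrite -(pair_bigA _ (fun s l => zhu x (s, l) * gm (ann a (s, l) v))) /=.
rewrite -sumrN big_mkcond; apply: eq_bigr => s _; rewrite /zhu /=.
case: eqP => [|_] /=; first by rewrite big1 // => l _; rewrite mul0r.
rewrite -sumrN; apply: eq_bigr => l _.
by rewrite mulNr [in RHS]mulrAC mulrA.
Qed.

Lemma ann_cre a x y v : gm (ann a x (cre a y v)) =
  gm (cre a y (ann a x v)) + (x == y)%:R * y.2.+1%:R * gm v.
Proof.
case: x y => [s k] [s' l]; rewrite /ann /cre xpair_eqE /=.
have [<-|ne] := eqVneq s s'; last first.
  rewrite mul0r mul0r addr0 setv_neq // [in RHS]setv_neq 1?eq_sym //.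
  by rewrite setvC // eq_sym.
rewrite !setv_eq !setv_setv (heis_comm V_heis) eqxx (mlinD gm_mlin).
rewrite (mlinZ gm_mlin) setv_id; congr (_ + _ * _).
rewrite (_ : (k.+1%:Z + - l.+1%:Z == 0) = (k == l)) /=; last first.
  by rewrite -val_eqE /=; lia.
by case: eqP => [->|_]; rewrite ?mul1r ?mul0r.
Qed.

Lemma cre_cre a x y v : gm (cre a x (cre a y v)) = gm (cre a y (cre a x v)).
Proof.
case: x y => [s k] [s' l]; rewrite /cre /=.
have [<-|ne] := eqVneq s s'; last first.
  by rewrite setv_neq // [in RHS]setv_neq 1?eq_sym // setvC // eq_sym.
rewrite !setv_eq !setv_setv (heis_comm V_heis) eqxx.
rewrite (_ : (- k.+1%:Z - l.+1%:Z == 0) = false) ?scale0r ?addr0 //; lia.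
Qed.

Definition sew2 a x y : fps g C := Sew (fun v => gm (cre a x (cre a y v))).

Lemma sew2C a x y : sew2 a x y = sew2 a y x.
Proof. by apply: eq_bigr => beta _; rewrite cre_cre. Qed.

Lemma sew_cre_ann a x y : eqd d (Sew (fun v => gm (cre a x (ann a y v))))
  (- (rho C y.1.1 ^+ y.2.+1 * sew2 a x (opp_idx y))).
Proof.
apply: (sew_contract V_heis B_LiZ b_basis bd_dual inj_eb ebP (Psi := fun v => gm (cre a x v))).
exact/mlin_mode/gm_mlin.
Qed.

(** The recursion replaces the operator at [x] by annihilation operators. Their commutator with the
    creation operator at [y] is the inhomogeneous term; once commuted past it they act on basis
    vectors and cross the handle. *)
Lemma sew_rec a x y : eqd d (sew2 a x y)
  (fpsC g (zhu x y * y.2.+1%:R) * Sew gm -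
   \sum_z fpsC g (zhu x (opp_idx z)) * (rho C z.1.1 ^+ z.2.+1 * sew2 a z y)).
Proof.
(* Cutting Zhu recursion at mode [d] requires higher modes to kill every vector: basis vectors have
   weight below [d], and the added creation operator has mode number at most [d]. *)
have cre_low beta s (l : nat) : (d < l)%N -> mode (h a) l%:Z (cre a y (vb beta) s) = 0.
  move=> dl; have low s' : mode (h a) l%:Z (vb beta s') = 0.
    apply: (heis_bs_eq0 V_heis B_LiZ b_basis bd_dual); apply: ltn_trans dl.
    exact: (wt_eb ebP).
  rewrite /cre /setv; case: eqP => // _; rewrite (heis_comm V_heis) low mode0r add0r eqxx.
  by rewrite ifF ?scale0r //=; have := ltn_ord y.2; lia.
have -> : sew2 a x y = fpsC g (zhu x y * y.2.+1%:R) * Sew gm +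
    \sum_z fpsC g (zhu x z) * Sew (fun v => gm (cre a y (ann a z v))).
  rewrite /sew2 /sew mulr_sumr.
  under [X in _ + X]eq_bigr => z _ do rewrite mulr_sumr.
  rewrite exchange_big -big_split /=; apply: eq_bigr => beta _.
  under eq_bigr => z _ do rewrite mulrCA -fpsCM.
  rewrite mulrCA -fpsCM -mulr_sumr -mulrDr -fpsC_sum -fpsCD; congr (_ * fpsC g _).
  rewrite slab_corr_zhu; last exact: cre_low.
  under eq_bigr => z _ do rewrite ann_cre mulrDr.
  rewrite big_split addrC /=; congr (_ + _).
  rewrite (sum_only (t0 := y)) => [|z zy]; last by rewrite (negPf zy) !mul0r mulr0.
  by rewrite eqxx mul1r mulrA.
(* The renaming by [opp_idx] puts the operator that has crossed the handle back at [z]. *)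
apply: eqdD => //; rewrite -sumrN (reindex_inj (inv_inj opp_idxK)) /=.
apply: eqd_sum => z _; rewrite -mulrN; apply: eqdM => //.
apply: (eqd_trans (sew_cre_ann _ _ _)); rewrite opp_idxK sew2C.
by case: z => -[].
Qed.

End SewnCorrelator.

(** * The sewing matrix *)

Section SewingMatrix.
Variables (C : numClosedFieldType) (g : nat) (w : slab g -> C) (d : nat).
Implicit Types (x y z : slab g * 'I_d).

Definition mode_idx x : slab g * nat := (x.1, x.2.+1).
Definition spow x : fps g C := srho C x.1.1 ^+ x.2.+1.
Definition isqrt x : C := (sqrtC x.2.+1%:R)^-1.

Lemma mode_idx_inj : injective mode_idx.
Proof. by case=> s k [s' k'] /= [-> /val_inj ->]. Qed.

Lemma isqrt_sq x : isqrt x * isqrt x * x.2.+1%:R = 1.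
Proof.
rewrite /isqrt -invfM -expr2 sqrtCK mulVf //.
by rewrite pnatr_eq0.
Qed.

Lemma rho_spow x : rho C x.1.1 ^+ x.2.+1 = spow x * spow x.
Proof. by rewrite /rho /spow -exprM -exprD mul2n addnn. Qed.

(** Converts the binomial of Zhu recursion, times the mode number, into the factorials of A. *)
Lemma gbin_fact_neg (k l : nat) : gbin C (- k.+1%:Z) l.+1 * l.+1%:R =
  (-1) ^+ l.+1 * (l + k).+1`!%:R / (l`!%:R * k`!%:R).
Proof.
have f0 m : m`!%:R != 0 :> C by rewrite pnatr_eq0 -lt0n fact_gt0.
apply: (canRL (mulfK _)); first by rewrite mulf_neq0.
rewrite gbin_neg -!mulrA; congr (_ * _); rewrite -!natrM; congr (_%:R).
have := bin_fact (leq_addl k l.+1); rewrite addnK factS => E.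
have -> : (l + k).+1 = (k + l.+1)%N by lia.
by rewrite -E !mulnA.
Qed.

(** An entry of A is the Zhu coefficient from [x] to the far end of the handle of [y], times the
    mode number left by the commutator, symmetrized by [isqrt] and [spow]. As [zhu] subtracts the
    point of its first argument, [x] is the column. *)
Lemma sewing_mxE x y : sewing_mx w (mode_idx y) (mode_idx x) =
  fpsC g (- (isqrt x * isqrt y * y.2.+1%:R * zhu w x (opp_idx y))) * (spow y * spow x).
Proof.
case: x y => [s k] [t l]; rewrite /sewing_mx /mode_idx /zhu /opp_idx /spow /isqrt /=.
have -> : (t == sneg s) = (sneg t == s).
  by apply/eqP/eqP => [->|<-]; case: (s) (t) => [? []] [? []].
case: eqP => _; first by rewrite mulr0 oppr0 fpsC0 mul0r.
rewrite -mulrA; congr (fpsC g _ * _); rewrite mulrN opprK.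
rewrite natrM rootCMl ?ler0n //= [(k.+1 + l.+1)%N]addnC.
rewrite [RHS]mulrA; congr (_ / _).
rewrite -[RHS]mulrA [l.+1%:R * _]mulrC gbin_fact_neg addnS /= !invfM; ring.
Qed.

Definition idx (i : 'I_#|{: slab g * 'I_d}|) : slab g * 'I_d := enum_val i.
Definition smx : 'M[fps g C]_#|{: slab g * 'I_d}| :=
  \matrix_(i, j) sewing_mx w (mode_idx (idx i)) (mode_idx (idx j)).

Lemma sewing_mx_small (x y : slab g * nat) (m : nat) :
  (m <= x.2 + y.2)%N -> eqd m (sewing_mx w x y) 0.
Proof.
case: x y => [s k] [t l] /= le; case: ifP => // _; rewrite -mulrA; apply: eqd0Mr.
by apply: eqdW le _; apply: eqd0M; apply: eqd_fpsXn.
Qed.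

Lemma euler_sewing_mx (x y : slab g * nat) :
  euler (sewing_mx w x y) = (x.2%:R + y.2%:R) * sewing_mx w x y.
Proof.
case: x y => [s k] [t l] /=; case: ifP => _; first by rewrite raddf0 mulr0.
rewrite -mulrA eulerCM eulerM !euler_fpsXn; ring.
Qed.

Lemma mode_idx_surj (x : slab g * nat) : (0 < x.2 <= d)%N -> exists i, x = mode_idx (idx i).
Proof.
case: x => s [|k] //= kd; exists (enum_rank (s, Ordinal kd)).
by rewrite /idx enum_rankK.
Qed.

Local Notation L := (fps_sum [set k : nat | (0 < k)%N]
  (fun k => fpsC g (k%:R^-1) *
     imx_trace (@sewing_idx g) (imx_exp (@sewing_idx g) (sewing_mx w) k))).

Lemma smx_inj : injective (mode_idx \o idx).
Proof. exact: inj_comp mode_idx_inj enum_val_inj. Qed.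

Lemma smx_large (x y : slab g * nat) : sewing_idx x -> sewing_idx y ->
  (forall i, x <> mode_idx (idx i)) \/ (forall i, y <> mode_idx (idx i)) ->
  eqd d (sewing_mx w x y) 0.
Proof.
rewrite /sewing_idx /= => x0 y0 nxy; apply: sewing_mx_small.
have big (z : slab g * nat) : (0 < z.2)%N -> (forall i, z <> mode_idx (idx i)) ->
    (d <= z.2)%N.
  move=> z0 nz; rewrite leqNgt; apply/negP => zd.
  by have [|i /nz] := mode_idx_surj (x := z); rewrite // z0 ltnW.
by case: nxy => /big H; [apply: leq_trans (leq_addr _ _)|apply: leq_trans (leq_addl _ _)];
  apply: H.
Qed.

Lemma smx_ord (x y : slab g * nat) : sewing_idx x -> sewing_idx y ->
  eqd 1 (sewing_mx w x y) 0.
Proof.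
by rewrite /sewing_idx /= => x0 _; apply: sewing_mx_small; apply: leq_trans (leq_addr _ _).
Qed.

Lemma eqd_smxX k i j : eqd k ((smx ^+ k) i j) 0.
Proof.
exact: (@eqd_mxX _ _ _ (@sewing_idx g) (sewing_mx w) _ (mode_idx \o idx) (fun=> isT) smx_ord).
Qed.

Lemma eqd_euler_log : eqd d (euler L)
  (\sum_(m < d) 2%:R * \sum_i (idx i).2.+1%:R * (smx ^+ m.+1) i i).
Proof.
apply: (eqd_trans (@eqd_euler_log_det _ _ _ (@sewing_idx g) (sewing_mx w) d _
  (mode_idx \o idx) smx_inj (fun=> isT) smx_large smx_ord)).
apply: eqd_sum => m _; rewrite -/smx.
pose N := diag_mx (\row_i (idx i).2.+1%:R) : 'M[fps g C]_#|{: slab g * 'I_d}|.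
have -> : map_mx (@euler g C) smx = N * smx + smx * N.
  apply/matrixP => i j; rewrite !mxE euler_sewing_mx /= mulrDl.
  have := mul_diag_mx (\row_i (idx i).2.+1%:R) smx.
  move=> /matrixP /(_ i j); rewrite !mxE => ->.
  have := mul_mx_diag smx (\row_i (idx i).2.+1%:R).
  by move=> /matrixP /(_ i j); rewrite !mxE => ->; rewrite [X in _ + X]mulrC.
rewrite mulrDl mxtraceD -!mulrA [X in _ + X]mxtrace_mulC -[_ *m smx]mulrA -exprS -exprSr.
rewrite -mulr2n mulr_natl (_ : \tr _ = \sum_i (idx i).2.+1%:R * (smx ^+ m.+1) i i) //.
rewrite /mxtrace; apply: eq_bigr => i _.
by have /matrixP /(_ i i) := mul_diag_mx (\row_i (idx i).2.+1%:R) (smx ^+ m.+1); rewrite !mxE.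
Qed.

End SewingMatrix.

(** The absence of a constant term is what gives [fps_exp] its meaning at this series. *)
Lemma eqd1_log (C : numClosedFieldType) (g : nat) (w : slab g -> C) :
  eqd 1 (fps_sum [set k : nat | (0 < k)%N] (fun k => fpsC g (k%:R^-1) *
    imx_trace (@sewing_idx g) (imx_exp (@sewing_idx g) (sewing_mx w) k))) 0.
Proof.
apply: (eqd_trans (@eqd_log_det _ _ _ (@sewing_idx g) (sewing_mx w) 1 _
  (@mode_idx g 1 \o @idx g 1) (@smx_inj g 1) (fun=> isT) (@smx_large _ g w 1)
  (@smx_ord _ g w))).
apply: eqd_sum0 => k _; apply: eqd0Mr; apply: eqd_sum0 => i _.
by apply: eqdW (ltn0Sn k) _; apply: eqd_smxX.
Qed.

(** * Comparison of the Euler derivatives and of the constant terms *)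

Section Assembly.
Variables (C : numClosedFieldType) (V : voa C) (h : 'I_2 -> V).
Hypothesis V_heis : heisenberg2 h.
Variable B : V -> V -> C.
Hypothesis B_LiZ : LiZ_metric B.
Variables (I : choiceType) (b bd : I -> V) (wt : I -> nat).
Hypothesis b_basis : homog_basis b wt.
Hypothesis bd_dual : dual_basis B b bd.
Variables (g : nat) (w : slab g -> C).
Hypothesis inj_w : injective w.

Section Truncation.
Variable d : nat.
Variables (T : finType) (eb : T -> I).
Hypothesis inj_eb : injective eb.
Hypothesis ebP : forall i, (wt i < d)%N <-> exists t, i = eb t.

Local Notation gm := (slab_corr B w).
Local Notation Sew := (sew b bd wt eb).
Local Notation Z := (Sew gm).
Local Notation sew2 := (sew2 h B b bd wt w eb).
Local Notation spow := (spow C).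
Local Notation isqrt := (isqrt C).
Local Notation smx := (smx w d).
Implicit Types (x y z : slab g * 'I_d) (a : 'I_2).

(* The factors spow and isqrt make the recursion of sew2 one for the sewing
   matrix itself, without dividing by powers of rho. *)
Definition sewn_mx a x y : fps g C :=
  - (fpsC g (isqrt x * isqrt y) * (spow x * spow y) * sew2 a x (opp_idx y)).

Lemma sewn_mx_rec a x y : eqd d (sewn_mx a x y)
  (sewing_mx w (mode_idx y) (mode_idx x) * Z +
   \sum_z sewing_mx w (mode_idx z) (mode_idx x) * sewn_mx a z y).
Proof.
have R := sew_rec V_heis B_LiZ b_basis bd_dual inj_w inj_eb ebP a x (opp_idx y).
move: (Sew gm) R => Z0 R.
apply: (eqd_trans (eqdN (eqdM (@eqd_refl _ _ _ _) R))).
rewrite mulrBr opprB addrC -mulrN mulr_sumr.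
have -> : fpsC g (isqrt x * isqrt y) * (spow x * spow y) *
    - (fpsC g (zhu w x (opp_idx y) * (opp_idx y).2.+1%:R) * Z0) =
    sewing_mx w (mode_idx y) (mode_idx x) * Z0.
  by rewrite sewing_mxE !(fpsCM, fpsCN) /=; ring.
apply: eqdD => //; apply: eqd_sum => z _.
apply: eq_eqd.
(* The matrix entry and [sewn_mx] each bring a factor [isqrt z]; the mode number of [z] in
   [sewing_mxE] cancels their product. *)
have E : fpsC g (isqrt z) * fpsC g (isqrt z) * fpsC g z.2.+1%:R = 1.
  by rewrite -!fpsCM isqrt_sq.
rewrite sewing_mxE /sewn_mx !(fpsCM, fpsCN) -[LHS]mul1r -E rho_spow; ring.
Qed.

(** Substituting the recursion into itself avoids inverting 1 - A: the remainder contains the [n]-th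
    power of A and has order at least [n]. *)
Lemma sewn_mx_iter a (n : nat) (i j : 'I_#|{: slab g * 'I_d}|) :
  eqd d (sewn_mx a (idx i) (idx j))
    (Z * \sum_(m < n) (smx ^+ m.+1) j i +
     \sum_l (smx ^+ n) l i * sewn_mx a (idx l) (idx j)).
Proof.
elim: n => [|n IH].
  rewrite big_ord0 mulr0 add0r expr0 (sum_only (t0 := i)) => [|l li].
    by rewrite mxE eqxx mul1r.
  by rewrite mxE (negPf li) mul0r.
apply: (eqd_trans IH); rewrite big_ord_recr /= mulrDr -addrA; apply: eqdD => //.
apply: (@eqd_trans _ _ _ (\sum_l (smx ^+ n) l i * (smx j l * Z +
    \sum_t smx t l * sewn_mx a (idx t) (idx j)))).
  apply: eqd_sum => l _; apply: eqdM => //; apply: (eqd_trans (sewn_mx_rec _ _ _)).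
  rewrite mxE; apply: eqdD => //.
  rewrite (reindex (@idx g d)) /=; last exact: onW_bij (enum_val_bij _).
  by apply: eqd_sum => t _; rewrite mxE.
have -> : (smx ^+ n.+1) j i = \sum_l smx j l * (smx ^+ n) l i by rewrite exprS mxE.
move: Z => Z0; rewrite (eq_bigr (fun l => (smx ^+ n) l i * (smx j l * Z0) +
    (smx ^+ n) l i * \sum_t smx t l * sewn_mx a (idx t) (idx j))); last first.
  by move=> l _; rewrite mulrDr.
rewrite big_split mulr_sumr; apply: eqdD.
  by apply: eqd_sum => l _; apply: eq_eqd; ring.
under [X in eqd d X _]eq_bigr => l _ do rewrite mulr_sumr.
rewrite exchange_big; apply: eqd_sum => t _.
by rewrite exprS mxE mulr_suml; apply: eqd_sum => l _; apply: eq_eqd; ring.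
Qed.

Lemma eqd_euler_sew : eqd d (euler Z)
  (Z * \sum_(m < d) 2%:R * \sum_i (idx i).2.+1%:R * (smx ^+ m.+1) i i).
Proof.
rewrite (euler_sew V_heis B_LiZ b_basis bd_dual inj_w ebP).
apply: (@eqd_trans _ _ _ (\sum_(a < 2) \sum_i (idx i).2.+1%:R *
    sewn_mx a (idx i) (idx i))).
  apply: eqd_sum => a _; rewrite (reindex (@idx g d)) /=; last first.
    exact: onW_bij (enum_val_bij _).
  apply: eqd_sum => i _; set x := idx i.
  apply: (eqd_trans (sew_cre_ann V_heis B_LiZ b_basis bd_dual inj_w inj_eb ebP a x x)).
  have E : fpsC g (isqrt x) * fpsC g (isqrt x) * fpsC g x.2.+1%:R = 1.
    by rewrite -!fpsCM isqrt_sq.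
  by apply: eq_eqd; rewrite /sewn_mx -fpsC_nat fpsCM rho_spow -[LHS]mul1r -E; ring.
move: (fun a i j => @sewn_mx_iter a d i j); move: Z => Z0 R.
apply: (@eqd_trans _ _ _ (\sum_(a < 2) \sum_i (idx i).2.+1%:R *
    (Z0 * \sum_(m < d) (smx ^+ m.+1) i i))).
  apply: eqd_sum => a _; apply: eqd_sum => i _; apply: eqdM => //.
  apply: (eqd_trans (R a i i)); rewrite -[X in eqd d _ X]addr0; apply: eqdD => //.
  by apply: eqd_sum0 => l _; apply: eqd0Ml; apply: eqd_smxX.
(* The bound no longer depends on the field [a], so the sum over the two fields is the factor 2. *)
apply: eq_eqd; rewrite sumr_const card_ord -[in RHS]mulr_sumr [RHS]mulrCA mulr_natl.
congr (_ *+ 2); rewrite exchange_big mulr_sumr; apply: eq_bigr => i _.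
by rewrite -mulr_sumr mulrCA.
Qed.

Lemma eqd_partition_function : eqd d (partition_function w B b bd wt) Z.
Proof.
apply: (eqd_trans (@eqd_fps_sum _ _ _ _ _ _ {ffun 'I_g -> T}
    (fun beta => [ffun e => eb (beta e)]) _ _ _)).
- move=> beta beta' /ffunP E; apply/ffunP => a; apply: inj_eb.
  by have := E a; rewrite !ffunE.
- by [].
- move=> gamma _ ngamma.
  have [e le] : exists e : 'I_g, (d <= wt (gamma e))%N.
    apply: contrapT => na; have /choice[t tP] : forall e : 'I_g, exists t, gamma e = eb t.
      by move=> e; apply/ebP; rewrite ltnNge; apply/negP => le; apply: na; exists e.
    by apply: (ngamma [ffun e => t e]); apply/ffunP => e; rewrite !ffunE.
  rewrite (bigD1 e) //= -mulrA; apply: eqd0Ml.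
  rewrite /rho -exprM; apply: eqd_fpsXn; apply: leq_trans le _.
  by rewrite mul2n -addnn leq_addl.
apply: eqd_sum => beta _; apply: eq_eqd; rewrite slab_corrE; congr (_ * fpsC g _).
  by apply: eq_bigr => a _; rewrite ffunE.
congr (corr B _); rewrite /slab_seq map_flatten -[in RHS](map_comp _ _ (enum _)); congr flatten.
by apply: eq_map => a /=; rewrite !ffunE.
Qed.

End Truncation.

Lemma slab_corr_vac_mul (s : seq (slab g)) (c : slab g -> C) : uniq s ->
  slab_corr B w (fun x => if x \in s then c x *: vac else vac) = \prod_(x <- s) c x.
Proof.
elim: s => [|x s IH] /= => [_|/andP[xs us]]; first by rewrite big_nil slab_corr_vac.
rewrite big_cons -IH // -(setv_id (fun z => if z \in s then _ else _) x) (negPf xs).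
rewrite -(mlinZ (gm_mlin V_heis B_LiZ inj_w)); congr slab_corr.
by apply/funext => z; rewrite /setv inE; case: eqP => [->|].
Qed.

(** All basis vectors of weight 0 are multiples of the vacuum, so the correlator factors over the
    handles; summed over the basis, each factor is the expansion of B(vac, vac) = 1. *)
Lemma partition_function_coef0 : eqd 1 (partition_function w B b bd wt) 1.
Proof.
have [s sP] := low_weight_enum b_basis 1.
have ebP i : (wt i < 1)%N <-> exists t : seq_sub s, i = val t.
  rewrite -sP; split=> [si|[t ->]]; last exact: valP.
  by exists (SeqSub si).
apply: (eqd_trans (eqd_partition_function val_inj ebP)); apply: eq_eqd.
have wt0 (t : seq_sub s) : wt (val t) = 0%N.
  by apply/eqP; rewrite -leqn0 -ltnS; apply: wt_eb ebP t.
pose bsc := bs b bd.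
have vacE c (t : seq_sub s) : bsc c (val t) = B (bsc c (val t)) vac *: vac.
  apply: (weight0_vac V_heis B_LiZ b_basis).
  by rewrite (bs_wt V_heis B_LiZ b_basis bd_dual) wt0 scale0r.
have gmE (beta : {ffun 'I_g -> seq_sub s}) : slab_corr B w (vb b bd val beta) =
    \prod_(a < g) (B (b (val (beta a))) vac * B (bd (val (beta a))) vac).
  transitivity (\prod_(x : slab g) B (vb b bd val beta x) vac).
    rewrite -[RHS]big_enum -slab_corr_vac_mul ?enum_uniq //; congr slab_corr.
    by apply/funext => x; rewrite mem_enum; exact: vacE.
  rewrite -(pair_bigA _ (fun a c => B (vb b bd val beta (a, c)) vac)) /=.
  by apply: eq_bigr => a _; rewrite big_bool.
have rhow1 (beta : {ffun 'I_g -> seq_sub s}) : rhow C wt val beta = 1.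
  by apply: big1 => a _; have -> : wt (val (beta a)) = 0%N by exact: wt0.
rewrite /sew; under eq_bigr => beta _ do rewrite rhow1 mul1r gmE.
rewrite -fpsC_sum -(bigA_distr_bigA (fun (a : 'I_g) t => B (b (val t)) vac * B (bd (val t)) vac)).
rewrite big1 // => a _.
have vac0 : vir 0 vac = 0%:~R *: vac :> V.
  by rewrite /vir add0r creation0 // scale0r.
have lt01 : 0%Z < 1%:Z by [].
have /(congr1 (B vac)) := complete_bs V_heis B_LiZ b_basis bd_dual val_inj ebP true lt01 vac0.
rewrite (B_vac B_LiZ) (B_sumr B_LiZ) => ->; apply: eq_bigr => t _.
by rewrite (BZr B_LiZ) mulrC (B_sym B_LiZ vac).
Qed.

Theorem partition_function_det :
  partition_function w B b bd wt = (imx_det1B (@sewing_idx g) (sewing_mx w))^-1.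
Proof.
set Z := partition_function _ _ _ _ _; rewrite /imx_det1B.
set L := fps_sum _ _.
have L0 : eqd 1 L 0 by exact: eqd1_log.
have mL0 : eqd 1 (- L) 0 by rewrite -oppr0; apply: eqdN.
have DZ : euler Z = Z * euler L.
  apply: eqd_eq => d; have [s sP] := low_weight_enum b_basis d.
  have ebP i : (wt i < d)%N <-> exists t : seq_sub s, i = val t.
    rewrite -sP; split=> [si|[t ->]]; last exact: valP.
    by exists (SeqSub si).
  have ZE := eqd_partition_function val_inj ebP.
  apply: (eqd_trans (eqd_euler ZE)); apply: (eqd_trans (eqd_euler_sew val_inj ebP)).
  by apply: eqdM; apply: eqd_sym => //; apply: eqd_euler_log.
have DZE : euler (Z * fps_exp (- L)) = 0.
  by rewrite eulerM DZ euler_fps_exp // raddfN /=; ring.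
have ZE1 : Z * fps_exp (- L) = 1.
  rewrite -fpsC1; apply: euler_eq0 => //.
  have : eqd 1 (Z * fps_exp (- L)) (1 * 1).
    apply: eqdM; first exact: partition_function_coef0.
    move=> m; rewrite ltnS leqn0 mdeg_eq0 => /eqP ->.
    by rewrite fps_exp_coef0 //= eqxx.
  by move=> /(_ 0%MM); rewrite mdeg0 mulr1 => -> //=; rewrite eqxx.
(* [ZE1] also shows the determinant to be a unit, so that its formal inverse is a true one. *)
by rewrite mulrC in ZE1; rewrite (mulr1_eq ZE1).
Qed.

End Assembly.

Theorem proposition4p1 (R : realType) (g : nat) (g_gt0 : (0 < g)%N)
    (w : slab g -> R[i]) (w_inj : injective w)
    (V : voa R[i]) (h : 'I_2 -> V) (V_heis : heisenberg2 h)
    (B : V -> V -> R[i]) (B_LiZ : LiZ_metric B)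
    (I : choiceType) (b bd : I -> V) (wt : I -> nat)
    (b_basis : homog_basis b wt) (bd_dual : dual_basis B b bd) :
  partition_function w B b bd wt
  = (imx_det1B (@sewing_idx g) (sewing_mx w))^-1.
Proof. exact: (partition_function_det V_heis B_LiZ b_basis bd_dual w_inj). Qed.
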